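(* Let $(\Omega,\mathcal{B}(\Omega),P)$ be an atomless (standard) Borel probability space, let $(\mathbf{W},d_1)$ be the space of symmetric measurable functions $\Omega^2\to[0,1]$ with the $L_1$-metric, and let $(\widehat{\mathbf{W}},\delta_{\square})$ be the quotient of $\mathbf{W}$ by weak isomorphism, equipped with the cut metric. Then there is a sequence $(\xi_n)_{n\in\mathbb{N}}$ of Borel-measurable mappings $\xi_n:(\widehat{\mathbf{W}},\delta_{\square})\to(\mathbf{W},d_1)$ such that, for every $\widehat{w}\in\widehat{\mathbf{W}}$, the set $\{\xi_n(\widehat{w})\mid n\in\mathbb{N}\}$ is a $d_1$-dense subset of the equivalence class $[\widehat{w}]_{\square}\subset\mathbf{W}$ (in particular, $\xi_n(\widehat{w})\in[\widehat{w}]_{\square}$ for all $n$ and all $\widehat{w}$).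
   Context: $(\Omega,\mathcal{B}(\Omega),P)$ is an atomless Borel probability space, i.e. $\Omega$ is a standard Borel space with an atomless probability measure $P$. $L_1(\Omega^2)$ is the Banach space of ($P\otimes P$-a.e. classes of) integrable functions on $\Omega\times\Omega$, with $L_1$-metric $d_1(w,w')=\int_{\Omega^2}|w-w'|\,d(P\otimes P)$. $\mathbf{W}\subset L_1(\Omega^2)$ is the subset of symmetric functions with values in $[0,1]$, equipped with $d_1$. For bounded measurable symmetric $u:\Omega^2\to\mathbb{R}$, the cut norm is $$\|u\|_{\square}=\sup_{S,T\in\mathcal{B}(\Omega)}\left|\int_{S\times T}u(s,t)\,dP(s)\,dP(t)\right|.$$ For $w,w'\in\mathbf{W}$ define $$\delta_{\square}(w,w')=\inf_{\psi}\|w^{\psi}-w'\|_{\square},\qquad w^{\psi}(x,y)=w(\psi(x),\psi(y)),$$ where the infimum runs over all invertible measure-preserving transformations of $\Omega$, i.e. all invertible measurable mappings $\psi:\Omega\to\Omega$ whose push-forward satisfies $\psi P=P$. This is a pseudo-metric on $\mathbf{W}$. Elements $w,w'\in\mathbf{W}$ are weakly isomorphic, $w\equiv w'$, if $\delta_{\square}(w,w')=0$. $\widehat{\mathbf{W}}$ denotes the set of equivalence classes of $\equiv$; $\delta_{\square}$ induces a metric on $\widehat{\mathbf{W}}$, also denoted $\delta_{\square}$. For $\widehat{w}\in\widehat{\mathbf{W}}$, $[\widehat{w}]_{\square}\subset\mathbf{W}$ denotes the corresponding equivalence class, viewed as a set of elements of $\mathbf{W}$. Measurability of maps is with respect to the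 Borel $\sigma$-algebras of the metric spaces $(\widehat{\mathbf{W}},\delta_{\square})$ and $(\mathbf{W},d_1)$. *)

(* Defs.v *)
From HB Require Import structures.
From mathcomp Require Import all_boot all_order all_algebra.
From mathcomp Require Import generic_quotient.
From mathcomp Require Import all_classical all_reals all_analysis.
From mathcomp Require Import measurable_realfun.

Set Implicit Arguments.
Unset Strict Implicit.
Unset Printing Implicit Defensive.

Import Order.TTheory GRing.Theory Num.Theory.
Import numFieldNormedType.Exports.

Local Open Scope classical_set_scope.
Local Open Scope ring_scope.
Local Open Scope quotient_scope.

Notation borel T := (g_sigma_algebraType (@open T)).

(* A completePseudoMetricType that is Hausdorff is a complete metric space;
   with second countability, T is Polish. *)
Definition standard_borel (R : realType) d (X : measurableType d) :=
  exists (T : completePseudoMetricType R) (f : X -> borel T),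
    [/\ hausdorff_space T, @second_countable T, bijective f &
        forall A : set X, measurable A <-> measurable (f @` A)].

Definition atomless (R : realType) d (X : measurableType d)
    (mu : {measure set X -> \bar R}) :=
  forall A, measurable A -> (0 < mu A)%E ->
    exists B, [/\ measurable B, B `<=` A, (0 < mu B)%E & (mu B < mu A)%E].

Section graphon.
Context d (Omega : measurableType d) (R : realType) (P : probability Omega R).
Local Notation PP := (P \x P)%E.

(* Elements of LspaceType1 are classes modulo a.e. equality, so symmetry and
   the bounds are required of some measurable representative. *)
Definition is_graphon (w : LspaceType1 PP) : Prop :=
  exists u : {mfun (Omega * Omega)%type >-> R},
    [/\ (u : _ -> R) = (w : _ -> R) %[ae PP],
        forall x y, u (x, y) = u (y, x) &
        forall z, 0 <= u z <= 1].

Definition graphon := {w : LspaceType1 PP | is_graphon w}.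

(* Evaluation goes through the representative chosen by the quotient. *)
Definition graphon_fun (w : graphon) : Omega * Omega -> R := sval w.
Coercion graphon_fun : graphon >-> Funclass.

Definition L1_dist (w w' : graphon) : R := \int[PP]_z `|w z - w' z|.

Definition cut_norm (u : Omega * Omega -> R) : R :=
  sup [set r | exists S T, [/\ measurable S, measurable T &
    r = `|\int[PP]_(z in S `*` T) u z|]].

Definition invertible_mpt (psi : Omega -> Omega) : Prop :=
  [/\ measurable_fun setT psi,
      exists phi : Omega -> Omega,
        [/\ measurable_fun setT phi, cancel psi phi & cancel phi psi] &
      forall A, measurable A -> pushforward P psi A = P A].

Definition relabel (u : Omega * Omega -> R) (psi : Omega -> Omega) :=
  fun z => u (psi z.1, psi z.2).

Definition cut_dist (w w' : graphon) : R :=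
  inf [set cut_norm (relabel w psi \- w') | psi in invertible_mpt].

Definition weakly_isomorphic (w w' : graphon) := `[< cut_dist w w' = 0 >].

HB.instance Definition _ := gen_eqMixin graphon.
HB.instance Definition _ := gen_choiceMixin graphon.

Lemma graphon_eq (w w' : graphon) :
  (w : _ -> R) = (w' : _ -> R) %[ae PP] -> w = w'.
Proof.
case: w w' => [[v [[vf]]] vP] [[v' [[vf']]] vP']; rewrite /graphon_fun/= => e.
have E : v = v' by have /eqP := introT (ae_eqP v v') e; rewrite !reprK.
case: _ / E vf' vP' {e} => vf' vP'.
case: _ / (Prop_irrelevance vf vf') vP' => vP'.
by rewrite (Prop_irrelevance vP vP').
Qed.

Lemma measurable_graphon (w : graphon) : measurable_fun setT (w : _ -> R).
Proof. exact: (@measurable_funPT _ _ _ _ (repr (sval w : aeEqMfun _ _))). Qed.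

Lemma graphon_integrable (w : graphon) : PP.-integrable setT (EFin \o w).
Proof.
apply/Lfun1_integrable; rewrite inE; apply/andP; split; rewrite inE/=.
  exact: measurable_graphon.
exact: (@Lebesgue_finite _ _ _ _ _ _ (sval w)).
Qed.

Let zero_class : {mfun_ PP, (Omega * Omega)%type >-> measurableTypeR R} :=
  \pi_({mfun_ PP, (Omega * Omega)%type >-> measurableTypeR R})
    (cst 0 : {mfun (Omega * Omega)%type >-> measurableTypeR R}).

Let zero_classE : (cst 0 : _ -> R) = (zero_class : _ -> R) %[ae PP].
Proof.
pose f0 : {mfun (Omega * Omega)%type >-> measurableTypeR R} := cst 0.
suff : ae_eq_op PP f0 (repr zero_class) by move/asboolP.
by rewrite -eqmodE reprK.
Qed.

Let zero_class_finite : finite_norm PP 1 zero_class.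
Proof.
rewrite /finite_norm Lnorm1 (ae_eq_integral (cst 0%E)).
- by rewrite integral0.
- by [].
- apply: measurableT_comp => //; apply/measurable_EFinP.
  exact: (@measurable_funPT _ _ _ _ (repr zero_class)).
- exact: measurable_cst.
- by apply: filterS zero_classE => z h /h /= <-; rewrite normr0.
Qed.

Let zero_Lspace : LspaceType1 PP :=
  HB.pack zero_class (isFinLebesgue.Build _ _ _ _ _ _ _ zero_class_finite).

Let zero_is_graphon : is_graphon zero_Lspace.
Proof. by exists (cst 0); split => // z; rewrite lexx ler01. Qed.

HB.instance Definition _ := isPointed.Build graphon
  (exist _ zero_Lspace zero_is_graphon).

Let integrable_funB (u v : Omega * Omega -> R) :
  PP.-integrable setT (EFin \o u) -> PP.-integrable setT (EFin \o v) ->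
  PP.-integrable setT (EFin \o (u \- v)).
Proof. exact: integrableB. Qed.

Let L1_distxx w : L1_dist w w = 0.
Proof.
rewrite /L1_dist (@eq_Rintegral _ _ _ _ _ (cst 0)).
  by rewrite Rintegral_cst// mul0r.
by move=> z _; rewrite subrr normr0.
Qed.

Let L1_dist_positivity w w' : L1_dist w w' = 0 -> w = w'.
Proof.
have iww' := integrable_funB (graphon_integrable w) (graphon_integrable w').
rewrite /L1_dist /Rintegral => /eqP; rewrite -eqe fineK; last first.
  exact/integrable_fin_num/integrable_norm.
move=> /eqP ww'0; apply: graphon_eq.
have := (ae_eq_integral_abs PP measurableT (measurable_int _ iww')).1 ww'0.
by apply: filterS => z /(_ I) [/eqP]; rewrite subr_eq0 => /eqP.
Qed.

Let L1_dist_sym w w' : L1_dist w w' = L1_dist w' w.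
Proof. by apply: eq_Rintegral => z _; rewrite distrC. Qed.

Let L1_dist_triangle w' w w'' : L1_dist w w'' <= L1_dist w w' + L1_dist w' w''.
Proof.
have iB u v := integrable_norm
  (integrable_funB (graphon_integrable u) (graphon_integrable v)).
rewrite /L1_dist -RintegralD//; [|exact: iB..].
apply: le_Rintegral => //; [exact: iB| |by move=> z _; exact: ler_distD].
exact: (integrableD measurableT (iB w w') (iB w' w'')).
Qed.

HB.instance Definition _ := @isMetric.Build R graphon
  L1_dist L1_distxx L1_dist_positivity L1_dist_sym L1_dist_triangle.

Let cut_norm_ub u S T : PP.-integrable setT (EFin \o u) ->
  measurable S -> measurable T ->
  `|\int[PP]_(z in S `*` T) u z| <= cut_norm u.
Proof.
move=> iu mS mT; apply: ub_le_sup; last by exists S, T.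
exists (\int[PP]_z `|u z|) => _ [A [B [mA mB ->]]].
have mAB : measurable (A `*` B) by exact: measurableX.
have iAB : PP.-integrable (A `*` B) (EFin \o u) by exact: integrableS iu.
apply: (le_trans (le_normr_Rintegral _ _)) => //.
rewrite /Rintegral fine_le//.
- by apply: integrable_fin_num => //; exact: integrable_norm.
- by apply: integrable_fin_num => //; exact: integrable_norm.
- apply: ge0_subset_integral => //.
  by apply: measurable_int; exact: integrable_norm iu.
Qed.

Let cut_norm_le u c : (forall S T, measurable S -> measurable T ->
  `|\int[PP]_(z in S `*` T) u z| <= c) -> cut_norm u <= c.
Proof.
move=> h; apply: ge_sup => [|_ [S [T [mS mT ->]]]]; last exact: h.
by exists `|\int[PP]_(z in set0 `*` set0) u z|, set0, set0.
Qed.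

Let cut_norm_ge0 u : PP.-integrable setT (EFin \o u) -> 0 <= cut_norm u.
Proof.
by move=> iu; apply: le_trans (cut_norm_ub iu measurable0 measurable0).
Qed.

Let cut_normD u v :
  PP.-integrable setT (EFin \o u) -> PP.-integrable setT (EFin \o v) ->
  cut_norm (u \+ v) <= cut_norm u + cut_norm v.
Proof.
move=> iu iv; apply: cut_norm_le => S T mS mT.
have mST : measurable (S `*` T) by exact: measurableX.
rewrite RintegralD//; [|exact: integrableS iu|exact: integrableS iv].
by rewrite (le_trans (ler_normD _ _))// lerD// cut_norm_ub.
Qed.

Let cut_normN u : PP.-integrable setT (EFin \o u) ->
  cut_norm (\- u) <= cut_norm u.
Proof.
move=> iu; apply: cut_norm_le => S T mS mT.
have mST : measurable (S `*` T) by exact: measurableX.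
rewrite (@eq_Rintegral _ _ _ _ _ (fun z => -1 * u z)); last first.
  by move=> z _; rewrite mulN1r.
rewrite RintegralZl//; last exact: integrableS iu.
by rewrite mulN1r normrN cut_norm_ub.
Qed.

Let pairmap (psi : Omega -> Omega) (z : Omega * Omega) := (psi z.1, psi z.2).

Let measurable_pairmap psi :
  measurable_fun setT psi -> measurable_fun setT (pairmap psi).
Proof.
move=> mpsi; apply: measurable_fun_pair => /=.
- by apply: (measurableT_comp mpsi); exact: measurable_fst.
- by apply: (measurableT_comp mpsi); exact: measurable_snd.
Qed.

Let pushforward_pairmap psi (mpp : measurable_fun setT (pairmap psi)) :
  invertible_mpt psi ->
  forall A, measurable A -> pushforward PP (pairmap psi) A = PP A.
Proof.
move=> [mpsi _ Ppsi] A mA.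
pose m' : {measure set _ -> \bar R} :=
  @measure_function_pushforward__canonical__measure_function_Measure
    _ _ _ _ _ PP _ mpp.
rewrite (@product_measure_unique _ _ _ _ _ P P m')// => B C mB mC.
rewrite /m'/= /pushforward.
have -> : pairmap psi @^-1` (B `*` C) = (psi @^-1` B) `*` (psi @^-1` C) by [].
have mpre D : measurable D -> measurable (psi @^-1` D).
  by move=> mD; rewrite -[X in measurable X]setTI; exact: mpsi.
rewrite product_measure1E; [|exact: mpre..].
by congr (_ * _)%E; exact: Ppsi.
Qed.

Let relabel_integrable u psi : invertible_mpt psi ->
  PP.-integrable setT (EFin \o u) ->
  PP.-integrable setT (EFin \o relabel u psi).
Proof.
move=> ipsi iu; have [mpsi _ _] := ipsi.
have mpp := measurable_pairmap mpsi.
have mu := measurable_int _ iu.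
apply/integrableP; split.
  rewrite (_ : EFin \o _ = (EFin \o u) \o pairmap psi)//.
  apply: (measurable_comp measurableT _ mu mpp) => //.
have /integrableP[_] := iu.
rewrite -[X in (X < _)%E -> _](@eq_measure_integral _ _ _ _ _
    (@measure_function_pushforward__canonical__measure_function_Measure
       _ _ _ _ _ PP _ mpp)); last first.
  by move=> A mA _; exact: pushforward_pairmap.
rewrite ge0_integral_pushforward//.
exact: measurable_int _ (integrable_abse iu).
Qed.

Let relabel_Rintegral u psi phi S T : invertible_mpt psi ->
  measurable_fun setT phi -> cancel psi phi ->
  PP.-integrable setT (EFin \o u) -> measurable S -> measurable T ->
  \int[PP]_(z in S `*` T) relabel u psi z =
  \int[PP]_(z in (phi @^-1` S) `*` (phi @^-1` T)) u z.
Proof.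
move=> ipsi mphi psiK iu mS mT; have [mpsi _ _] := ipsi.
have mpre D : measurable D -> measurable (phi @^-1` D).
  by move=> mD; rewrite -[X in measurable X]setTI; exact: mphi.
have mpp := measurable_pairmap mpsi.
have mu := measurable_int _ iu.
have mST : measurable ((phi @^-1` S) `*` (phi @^-1` T)).
  by apply: measurableX; exact: mpre.
have E : pairmap psi @^-1` ((phi @^-1` S) `*` (phi @^-1` T)) = S `*` T.
  by rewrite /pairmap; apply/seteqP; split => z /=; rewrite !psiK.
congr fine; rewrite -[RHS](@eq_measure_integral _ _ _ _ _
    (@measure_function_pushforward__canonical__measure_function_Measure
       _ _ _ _ _ PP _ mpp)); last first.
  by move=> A mA _; exact: pushforward_pairmap.
rewrite [RHS](integral_pushforward mpp mu)//= E//.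
apply: integrableS (relabel_integrable ipsi iu) => //; exact: measurableX.
Qed.

Let cut_norm_relabel u psi : invertible_mpt psi ->
  PP.-integrable setT (EFin \o u) -> cut_norm (relabel u psi) <= cut_norm u.
Proof.
move=> ipsi iu; have [_ [phi [mphi psiK phiK]] _] := ipsi.
have mpre D : measurable D -> measurable (phi @^-1` D).
  by move=> mD; rewrite -[X in measurable X]setTI; exact: mphi.
apply: cut_norm_le => S T mS mT.
by rewrite (relabel_Rintegral ipsi mphi psiK)// cut_norm_ub//; exact: mpre.
Qed.

Let invertible_mpt_id : invertible_mpt id.
Proof. by split => //; exists id; split. Qed.

Let invertible_mpt_comp psi phi :
  invertible_mpt psi -> invertible_mpt phi -> invertible_mpt (psi \o phi).
Proof.
move=> [mpsi [psi' [mpsi' psiK psi'K]] Ppsi].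
move=> [mphi [phi' [mphi' phiK phi'K]] Pphi].
split; first exact: measurableT_comp.
- exists (phi' \o psi'); split; first exact: measurableT_comp.
  + exact: can_comp.
  + exact: can_comp.
- move=> A mA; rewrite -[RHS]Ppsi// -[RHS]Pphi//.
  by rewrite -[X in measurable X]setTI; exact: mpsi.
Qed.

Let invertible_mpt_inv psi phi : invertible_mpt psi ->
  measurable_fun setT phi -> cancel psi phi -> cancel phi psi ->
  invertible_mpt phi.
Proof.
move=> [mpsi _ Ppsi] mphi psiK phiK; split => //; first by exists psi; split.
move=> A mA; rewrite /pushforward -Ppsi; last first.
  by rewrite -[X in measurable X]setTI; exact: mphi.
by congr (P _); apply/seteqP; split => x /=; rewrite psiK.
Qed.

Let cut_integrable (w w' : graphon) psi : invertible_mpt psi ->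
  PP.-integrable setT (EFin \o (relabel w psi \- w')).
Proof.
move=> ipsi; apply: integrable_funB; last exact: graphon_integrable.
by apply: relabel_integrable => //; exact: graphon_integrable.
Qed.

Let cut_dist_lb (w w' : graphon) :
  has_lbound [set cut_norm (relabel w psi \- w') | psi in invertible_mpt].
Proof.
by exists 0 => _ [psi ipsi <-]; apply: cut_norm_ge0; exact: cut_integrable.
Qed.

Let cut_dist_le (w w' : graphon) psi : invertible_mpt psi ->
  cut_dist w w' <= cut_norm (relabel w psi \- w').
Proof. by move=> ipsi; apply: ge_inf => //; exists psi. Qed.

Let cut_dist_ge (w w' : graphon) c :
  (forall psi, invertible_mpt psi -> c <= cut_norm (relabel w psi \- w')) ->
  c <= cut_dist w w'.
Proof.
move=> h; apply: lb_le_inf => [|_ [psi ipsi <-]]; last exact: h.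
by exists (cut_norm (relabel w id \- w')), id.
Qed.

Lemma cut_dist_ge0 w w' : 0 <= cut_dist w w'.
Proof.
by apply: cut_dist_ge => psi ipsi; apply: cut_norm_ge0; exact: cut_integrable.
Qed.

Lemma cut_distxx w : cut_dist w w = 0.
Proof.
apply/eqP; rewrite eq_le cut_dist_ge0 andbT.
apply: (le_trans (cut_dist_le _ _ invertible_mpt_id)).
apply: cut_norm_le => S T mS mT; rewrite (@eq_Rintegral _ _ _ _ _ (cst 0)).
  by rewrite Rintegral_cst ?mul0r ?normr0//; exact: measurableX.
by move=> [x y] _; rewrite /relabel/= subrr.
Qed.

Let cut_dist_sym_le w w' : cut_dist w' w <= cut_dist w w'.
Proof.
apply: cut_dist_ge => psi ipsi; have [_ [phi [mphi psiK phiK]] _] := ipsi.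
have iphi := invertible_mpt_inv ipsi mphi psiK phiK.
apply: (le_trans (cut_dist_le _ _ iphi)).
have iu := cut_integrable w w' ipsi.
rewrite (_ : _ \- _ = relabel (\- (relabel w psi \- w')) phi); last first.
  by apply/funext => -[x y]; rewrite /relabel/= !phiK opprB.
apply: le_trans (cut_normN iu); apply: cut_norm_relabel => //.
exact: (integrableN iu).
Qed.

Lemma cut_dist_sym w w' : cut_dist w w' = cut_dist w' w.
Proof. by apply/eqP; rewrite eq_le !cut_dist_sym_le. Qed.

Lemma cut_dist_triangle w' w w'' :
  cut_dist w w'' <= cut_dist w w' + cut_dist w' w''.
Proof.
rewrite -lerBlDr; apply: cut_dist_ge => psi ipsi.
rewrite lerBlDr -lerBlDl; apply: cut_dist_ge => phi iphi; rewrite lerBlDl.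
apply: (le_trans (cut_dist_le _ _ (invertible_mpt_comp ipsi iphi))).
have iu := cut_integrable w w' ipsi.
have iv := cut_integrable w' w'' iphi.
rewrite (_ : _ \- _ =
    relabel (relabel w psi \- w') phi \+ (relabel w' phi \- w'')); last first.
  by apply/funext => -[x y]; rewrite /relabel/= addrA subrK.
apply: (le_trans (cut_normD (relabel_integrable iphi iu) iv)).
by rewrite lerD2r; exact: cut_norm_relabel.
Qed.

Let weakly_isomorphic_refl : reflexive weakly_isomorphic.
Proof. by move=> w; apply/asboolP; exact: cut_distxx. Qed.

Let weakly_isomorphic_sym : symmetric weakly_isomorphic.
Proof. by move=> w w'; rewrite /weakly_isomorphic cut_dist_sym. Qed.

Let weakly_isomorphic_trans : transitive weakly_isomorphic.
Proof.
move=> w' w w'' /asboolP ww' /asboolP w'w''; apply/asboolP/eqP.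
rewrite eq_le cut_dist_ge0 andbT (le_trans (cut_dist_triangle w' _ _))//.
by rewrite ww' w'w'' addr0.
Qed.

Canonical weakly_isomorphic_equiv := EquivRel weakly_isomorphic
  weakly_isomorphic_refl weakly_isomorphic_sym weakly_isomorphic_trans.

Definition unlabeled_graphon : Type := {eq_quot weakly_isomorphic}.
HB.instance Definition _ := Choice.on unlabeled_graphon.
HB.instance Definition _ := EqQuotient.on unlabeled_graphon.

Definition weak_class (what : unlabeled_graphon) : set graphon :=
  [set w | \pi_unlabeled_graphon w = what].

Definition unlabeled_cut_dist (u v : unlabeled_graphon) : R :=
  cut_dist (repr u) (repr v).

HB.instance Definition _ := isPointed.Build unlabeled_graphon
  (\pi_unlabeled_graphon point).

Let weakP (w w' : graphon) :
  \pi_unlabeled_graphon w = \pi_unlabeled_graphon w' <-> cut_dist w w' = 0.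
Proof.
by split=> [/eqmodP/asboolP//|h]; apply/eqmodP/asboolP.
Qed.

Lemma unlabeled_cut_distE (w w' : graphon) :
  unlabeled_cut_dist (\pi w) (\pi w') = cut_dist w w'.
Proof.
have e (v : graphon) : cut_dist (repr (\pi_unlabeled_graphon v)) v = 0.
  by apply/weakP; rewrite reprK.
have h (a b a' b' : graphon) : cut_dist a a' = 0 -> cut_dist b b' = 0 ->
    cut_dist a b <= cut_dist a' b'.
  move=> aa' bb'; rewrite (le_trans (cut_dist_triangle a' _ _))// aa' add0r.
  rewrite (le_trans (cut_dist_triangle b' _ _))// [cut_dist b' b]cut_dist_sym.
  by rewrite bb' addr0.
by apply/eqP; rewrite eq_le !h// cut_dist_sym.
Qed.

Let ucdxx u : unlabeled_cut_dist u u = 0.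
Proof. exact: cut_distxx. Qed.

Let ucd_positivity u v : unlabeled_cut_dist u v = 0 -> u = v.
Proof. by move/weakP; rewrite !reprK. Qed.

Let ucd_sym u v : unlabeled_cut_dist u v = unlabeled_cut_dist v u.
Proof. exact: cut_dist_sym. Qed.

Let ucd_triangle v u t :
  unlabeled_cut_dist u t <= unlabeled_cut_dist u v + unlabeled_cut_dist v t.
Proof. exact: cut_dist_triangle. Qed.

HB.instance Definition _ := @isMetric.Build R unlabeled_graphon
  unlabeled_cut_dist ucdxx ucd_positivity ucd_sym ucd_triangle.

End graphon.

(* Main.v *)
From HB Require Import structures.
Require Import Defs.
From mathcomp Require Import all_boot all_order all_algebra.
From mathcomp Require Import generic_quotient.
From mathcomp Require Import all_classical all_reals all_analysis.
From mathcomp Require Import ring lra measurable_realfun.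

(** The sequence xi is a Castaing representation of the correspondence that
    sends an unlabeled graphon y to its weak isomorphism class, a closed
    nonempty subset of the space W of graphons with its L1 distance
    ([castaing_representation], which applies the Kuratowski--Ryll-Nardzewski
    theorem [measurable_selection] to countably many sub-correspondences).
    This needs W to be complete ([graphon_complete]) and separable
    ([graphon_separable]), and it needs the set of classes that meet a given
    open set U of W, that is, the image of U under the quotient map, to be
    Borel for the cut distance.

    The latter does not require any compactness of the space of unlabeled
    graphons.  First, the saturation of U is open.  Indeed, if w and w' are
    weakly isomorphic, then the relabellings of w come arbitrarily close to w'
    in L1 ([orbit_dense]).  On functions bounded by 1, convergence in cut norm
    implies weak convergence in L2 (by [cut_continuous_kernel], tested against
    graphons), so relabellings of w converge weakly to w'.  Since relabelling
    preserves the L2 norm, || w' ||_2 <= || w ||_2; by symmetry the norms are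
    equal, and weak convergence without loss of norm is strong convergence.  As
    relabelling is an isometry of W, every class near that of w meets U as well
    ([open_saturation]).

    Second, the image of U and the image of the complement of its saturation
    are disjoint continuous images of a countable union of closed sets and of a
    closed set.  Lusin's separation theorem for continuous images of closed
    subsets of a complete separable space ([lusin_separation]) gives a Borel
    set between them; since the two images cover the quotient, that set is the
    image of U ([measurable_image_open]). *)

Set Implicit Arguments.
Unset Strict Implicit.
Unset Printing Implicit Defensive.

Import Order.TTheory GRing.Theory Num.Theory.
Import numFieldNormedType.Exports.

Local Open Scope classical_set_scope.
Local Open Scope ring_scope.
Local Open Scope quotient_scope.

Local Notation half n := (2^-1 ^+ n).

(** * Rapidly converging sequences *)

Section rapidly_cauchy.
Context (R : realType) (X : pseudoMetricType R).
Implicit Types (x : nat -> X) (l : X).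

Lemma half_gt0 n : 0 < half n :> R.
Proof. by rewrite exprn_gt0// invr_gt0. Qed.

Lemma halfS n : half n.+1 + half n.+1 = half n :> R.
Proof. by rewrite exprS; lra. Qed.

Lemma half_lt (c e : R) : 0 < e -> exists n, c * half n < e.
Proof.
move=> e0; have [c0|c0] := leP c 0.
  by exists 0%N; rewrite expr0 mulr1 (le_lt_trans c0).
have /cvgrPdist_lt/(_ (e / c)) : (fun n => half n : R) @ \oo --> (0 : R).
  by apply: cvg_expr; rewrite ger0_norm// invf_lt1// ltr1n.
rewrite divr_gt0// => /(_ isT)[n _ /(_ n (leqnn _))].
rewrite sub0r normrN ger0_norm ?(ltW (half_gt0 _))// => h.
by exists n; rewrite mulrC -ltr_pdivlMr.
Qed.

(** Completeness, tested only on the sequences whose successive steps are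
    bounded by a fixed summable geometric sequence. *)
Definition rapidly_complete := forall x,
  (forall n, ball (x n) (half n) (x n.+1)) -> exists l, x @ \oo --> l.

Lemma rapid_tail x l n : (forall n, ball (x n) (half n) (x n.+1)) ->
  x @ \oo --> l -> ball (x n) (3 * half n) l.
Proof.
move=> xc xl; have tail k : forall n, ball (x n) (2 * half n) (x (n + k)%N).
  elim: k => [|k ih] m.
    by rewrite addn0; apply: ballxx; rewrite mulr_gt0 ?half_gt0.
  rewrite addnS -addSn (_ : 2 * _ = half m + 2 * half m.+1); last first.
    by rewrite -(halfS m); lra.
  exact: ball_triangle (xc m) (ih _).
have /cvg_ballP/(_ _ (half_gt0 n))[m _ /(_ (n + m)%N)] := xl.
move=> /(_ (leq_addl _ _))/ball_sym xm.
rewrite (_ : 3 * _ = 2 * half n + half n); last by lra.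
exact: ball_triangle (tail m n) xm.
Qed.

End rapidly_cauchy.

(** * Lusin separation and Borel images of open sets *)

Section lusin_separation.
Context (R : realType) (X : pseudoMetricType R) (Y : ptopologicalType).
Variables (p : X -> Y).

(** The images of [A] and [B] under [p] are separated by a Borel set of [Y]. *)
Definition borel_separated (A B : set X) := exists E : set (borel Y),
  [/\ measurable E, forall x, A x -> E (p x) & forall x, B x -> ~ E (p x)].

Lemma borel_separated_bigcup (A B : nat -> set X) :
  (forall i j, borel_separated (A i) (B j)) ->
  borel_separated (\bigcup_i A i) (\bigcup_j B j).
Proof.
move=> h; have /choice[E hE] ij := h ij.1 ij.2.
exists (\bigcup_i \bigcap_j E (i, j)); split.
- apply: bigcup_measurable => i _; apply: bigcap_measurable => [|j _].
    by exists 0%N.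
  by case: (hE (i, j)).
- by move=> x [i _ Ax]; exists i => // j _; have [_ + _] := hE (i, j); exact.
- move=> x [j _ Bx] [i _ /(_ j I)]; have [_ _] := hE (i, j); exact.
Qed.

(** Lusin's separation theorem.  If no Borel set separated the images, a
    countable cover by small balls would yield decreasing sequences of
    subsets of [F] and of [G], with diameters tending to 0, whose images are
    still not separated; they shrink to points with distinct images, and
    disjoint neighbourhoods of these images separate them in the end. *)
Lemma lusin_separation (u : nat -> X) (F G : set X) :
  rapidly_complete X -> (forall x e, 0 < e -> exists i, ball (u i) e x) ->
  hausdorff_space Y -> continuous p -> closed F -> closed G ->
  (forall x y, F x -> G y -> p x != p y) -> borel_separated F G.
Proof.
move=> cX du hY cp cF cG FG; apply: contrapT => nFG.
(* In the sequence [f] of pairs of nested pieces built below, the two pieces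
   of [f n.+1] satisfy [small n]. *)
pose small n (A : set X) := exists c, A `<=` ball c (half n.+1).
have step (nAB : nat * (set X * set X)) : exists AB : set X * set X,
    ~ borel_separated nAB.2.1 nAB.2.2 ->
    [/\ ~ borel_separated AB.1 AB.2,
        AB.1 `<=` nAB.2.1 /\ AB.2 `<=` nAB.2.2, small nAB.1 AB.1 &
        small nAB.1 AB.2].
  case: nAB => n [A B] /=; apply/not_existsP => /= h; have [hs|hs] :=
    pselect (borel_separated A B); first by case: (h (set0, set0)).
  apply: hs; have cover (C : set X) :
      C = \bigcup_i (C `&` ball (u i) (half n.+1)).
    rewrite -setI_bigcupr; apply/esym/setIidPl => x _.
    by have [i] := du x _ (half_gt0 R n.+1); exists i.
  rewrite (cover A) (cover B); apply: borel_separated_bigcup => i j.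
  apply: contrapT => nij; apply: (h (A `&` ball (u i) (half n.+1),
    B `&` ball (u j) (half n.+1))) => _; split=> //=.
  - by exists (u i) => x [].
  - by exists (u j) => x [].
have /choice[s hs] := step.
pose f := fix f n := if n is m.+1 then s (m, f m) else (F, G).
have fP n : ~ borel_separated (f n).1 (f n).2.
  by elim: n => //= n ih; have [] := hs (n, f n) ih.
have fF n : (f n).1 `<=` F /\ (f n).2 `<=` G.
  elim: n => [|n [ih1 ih2]] /=; first by split.
  have [_ [s1 s2] _ _] := hs (n, f n) (fP n).
  by split=> x; [move/s1/ih1|move/s2/ih2].
have f1 n : (f n).1 !=set0.
  apply: contrapT => /nonemptyPn f0; apply: (fP n).
  exists set0; split; [exact: measurable0|by move=> x; rewrite f0|].
  by move=> x _ [].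
have f2 n : (f n).2 !=set0.
  apply: contrapT => /nonemptyPn f0; apply: (fP n).
  by exists setT; split; [exact: measurableT|by []|by move=> x; rewrite f0].
(* The argument is the same for both components: [sel] is [fst] or [snd]. *)
have lim (sel : set X * set X -> set X) :
    (forall n, sel (f n) !=set0) ->
    (forall n, small n (sel (f n.+1)) /\ sel (f n.+1) `<=` sel (f n)) ->
    closed (sel (f 0%N)) ->
    exists2 l, sel (f 0%N) l &
      forall e, 0 < e -> \forall n \near \oo, sel (f n.+1) `<=` ball l e.
  move=> sel0 selS selc; have /choice[x xP] n := sel0 n.+1.
  have sel_ball n y z : sel (f n.+1) y -> sel (f n.+1) z ->
      ball y (half n) z.
    move=> fy fz; have [[c fc] _] := selS n.
    by rewrite -halfS; apply: ball_triangle (fc _ fz); exact/ball_sym/fc.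
  have sel_mono n k : sel (f (n + k)%N) `<=` sel (f n).
    elim: k => [|k ih]; first by rewrite addn0.
    by rewrite addnS; apply: subset_trans ih; case: (selS (n + k)%N).
  have xc n : ball (x n) (half n) (x n.+1).
    apply: sel_ball => //; have [_] := selS n.+1; exact.
  have [l xl] := cX x xc; exists l.
    apply: (closed_cvg (sel (f 0%N)) selc _ _ xl).
    by apply: nearW => n; exact: (sel_mono 0%N n.+1 _ (xP n)).
  move=> e e0; have [N hN] := half_lt 4 e0; exists N => // n /= Nn y fy.
  apply: (@le_ball _ _ _ (3 * half N + half N)).
    by rewrite -[X in _ + X]mul1r -mulrDl (_ : 3 + 1 = 4) ?ltW//; lra.
  apply: ball_triangle (ball_sym (rapid_tail N xc xl)) _.
  apply: sel_ball; first exact: xP.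
  by have := sel_mono N.+1 (n - N)%N; rewrite addSn subnKC//; apply.
have [//|n||l Fl hl] := lim fst.
- by have [_ []] := hs (n, f n) (fP n).
- exact: cF.
have [//|n||m Gm hm] := lim snd.
- by have [_ []] := hs (n, f n) (fP n).
- exact: cG.
have := hY; rewrite open_hausdorff => /(_ _ _ (FG _ _ Fl Gm)).
move=> [[V W] /= [/set_mem Vl /set_mem Wm] [oV oW /eqP VW]].
have /nbhs_ballP[e /= e0 eV] : nbhs l (p @^-1` V).
  by apply: cp; exact: open_nbhs_nbhs.
have /nbhs_ballP[e' /= e'0 eW] : nbhs m (p @^-1` W).
  by apply: cp; exact: open_nbhs_nbhs.
near \oo => n.
have le : (f n.+1).1 `<=` ball l e by near: n; exact: hl.
have me' : (f n.+1).2 `<=` ball m e' by near: n; exact: hm.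
apply: (fP n.+1); exists V; split=> [|x /le/eV//|x /me'/eW Wx Vx].
  exact: sub_sigma_algebra.
suff : (V `&` W) (p x) by rewrite VW.
by split.
Unshelve. all: by end_near.
Qed.

End lusin_separation.

Section open_image.
Context (R : realType) (X : pseudoMetricType R) (Y : ptopologicalType).
Variables (p : X -> Y) (u : nat -> X).
Hypotheses (cX : rapidly_complete X)
  (du : forall x (e : R), 0 < e -> exists i, ball (u i) e x).
Hypotheses (hY : hausdorff_space Y) (cp : continuous p).

(** An open set with open saturation has a Borel image under a continuous
    surjection: Lusin separation applies to the closed balls that exhaust
    [U], against the closed complement of the saturation. *)
Lemma measurable_image_open (U : set X) : (forall y, exists x, p x = y) ->
  open U -> open [set x | exists2 x', U x' & p x' = p x] ->
  measurable (p @` U : set (borel Y)).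
Proof.
move=> sp oU oS; pose S := [set x | exists2 x', U x' & p x' = p x].
pose C (ik : nat * nat) : set X := [set x |
  closed_ball (u ik.1) (half ik.2) `<=` U /\
  closed_ball (u ik.1) (half ik.2) x].
have CU ik : C ik `<=` U by move=> x [+]; exact.
have UC : U = \bigcup_n oapp C set0 (unpickle n).
  apply/seteqP; split=> [x Ux|x [n _]]; last first.
    by case: (unpickle n) => [ik /CU|[]].
  have : nbhs x U by exact: open_nbhs_nbhs.
  move=> /nbhs_ballP[e /= e0 eU]; have [k hk] := half_lt 3 e0.
  have [i uix] := du x (half_gt0 R k).
  exists (pickle (i, k)) => //=; rewrite pickleK/=; split; last first.
    exact: subset_closed_ball.
  move=> y; rewrite /= /closed_ball => /(_ _ (nbhsx_ballx _ _ (half_gt0 R k))).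
  move=> [z [uiz yz]]; apply: eU; apply: (@le_ball _ _ _ (3 * half k)).
    exact: ltW.
  rewrite (_ : 3 * _ = half k + half k + half k); last by lra.
  apply: ball_triangle (ball_sym yz).
  by apply: ball_triangle (ball_sym uix) uiz.
have sep n : borel_separated p (oapp C set0 (unpickle n)) (~` S).
  case: (unpickle n) => /= [ik|]; last first.
    by exists set0; split; [exact: measurable0|by []|by move=> x _ []].
  have [CikU|CikU] := pselect (closed_ball (u ik.1) (half ik.2) `<=` U);
    last first.
    by exists set0; split=> [|x []|x _ []]//; exact: measurable0.
  apply: (lusin_separation cX du hY cp).
  - rewrite (_ : C ik = closed_ball (u ik.1) (half ik.2)).
      exact: closed_ball_closed.
    by apply/seteqP; split=> x // [].
  - exact: open_closedC.
  - move=> x y /CU Ux Sy; apply/eqP => pxy; apply: Sy; by exists x.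
have [E [mE UE SE]] : borel_separated p U (~` S).
  rewrite UC [X in borel_separated p _ X](_ : _ = \bigcup_(n : nat) ~` S).
    exact: borel_separated_bigcup.
  by rewrite bigcup_const//; exists 0%N.
rewrite (_ : p @` U = E)//; apply/seteqP; split=> [_ [x Ux <-]|y Ey].
  exact: UE.
have [x xy] := sp y; rewrite -xy in Ey *.
have : S x by apply: contrapT => /SE.
by move=> [x' Ux' <-]; exists x'.
Qed.

End open_image.

(** * Measurable selections *)

Section selection.
Context (R : realType) (X : pseudoPMetricType R) d (Y : measurableType d).

(** The least index of a set containing the point depends measurably on it. *)
Lemma measurable_least_index (A : nat -> set Y) :
  (forall i, measurable (A i)) -> (forall y, exists i, A i y) ->
  exists j : Y -> nat,
    (forall i, measurable (j @^-1` [set i])) /\ forall y, A (j y) y.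
Proof.
move=> mA Ay; have Ab y : exists i, `[< A i y >].
  by have [i ?] := Ay y; exists i; apply/asboolP.
exists (fun y => ex_minn (Ab y)); split=> [i|y]; last first.
  by case: ex_minnP => m /asboolP.
rewrite (_ : _ @^-1` _ = A i `\` \big[setU/set0]_(k < i) A k).
  by apply: measurableD => //; exact: bigsetU_measurable.
apply/seteqP; split=> y /=; case: ex_minnP => m /asboolP Am minm.
  move=> <-; split=> //; rewrite -bigcup_mkord => -[k /= km Ak].
  by have := minm k; rewrite leqNgt km => /(_ (asboolT Ak)).
move=> [Ai]; rewrite -bigcup_mkord => nA; apply/eqP; rewrite eqn_leq.
rewrite minm ?andTb; last exact/asboolP.
by rewrite leqNgt; apply/negP => mi; apply: nA; exists m.
Qed.

Variables (u : nat -> X).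
Hypotheses (cX : rapidly_complete X)
  (du : forall x (e : R), 0 < e -> exists i, ball (u i) e x).

(* Balls of a pseudometric structure need not be open, whence the interior. *)
Let O i n := interior (ball (u i) (half n)).

Let openO i n : open (O i n). Proof. exact: open_interior. Qed.

Let O_ball i n x : O i n x -> ball (u i) (half n) x.
Proof. exact: interior_subset. Qed.

Let denseO x n : exists i, O i n x.
Proof.
have [i xi] := du x (half_gt0 R n.+1); exists i.
apply/nbhs_ballP; exists (half n.+1) => /=; first exact: half_gt0.
by move=> z xz; rewrite -(halfS R n); exact: ball_triangle xz.
Qed.

(** Weak measurability of a set-valued map: the points whose value meets a
    given open set form a measurable set. *)
Definition weakly_measurable (F : Y -> set X) :=
  forall U, open U -> measurable [set y | F y `&` U !=set0].

(** The Kuratowski--Ryll-Nardzewski selection theorem: a selection is the limit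
    of maps [y |-> u (j n y)], each with countably many values, where
    [u (j n y)] is within [half n.+1] of [F y] and within [half n] of
    [u (j n.+1 y)]. *)
Lemma measurable_selection (F : Y -> set X) :
  (forall y, closed (F y)) -> (forall y, F y !=set0) -> weakly_measurable F ->
  exists f : Y -> X, @measurable_fun _ _ Y (borel X) setT f /\
    forall y, F y (f y).
Proof.
move=> cF F0 mF.
pose good n (j : Y -> nat) := (forall i, measurable (j @^-1` [set i])) /\
  forall y, F y `&` O (j y) n.+1 !=set0.
have [j0 j0P] : exists j, good 0%N j.
  apply: (measurable_least_index
    (A := fun i => [set y | F y `&` O i 1 !=set0])) => [i|y].
    exact/mF/openO.
  have [x Fx] := F0 y; have [i xi] := denseO x 1.
  by exists i, x.
have step (nj : nat * (Y -> nat)) : exists j, good nj.1 nj.2 ->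
    good nj.1.+1 j /\
    forall y, ball (u (nj.2 y)) (half nj.1) (u (j y)).
  case: nj => n j /=; have [[mj Fj]|] := pselect (good n j); last by exists j.
  pose A i := [set y | F y `&` (O i n.+2 `&` O (j y) n.+1) !=set0].
  have [i|y|j' [mj' j'P]] := measurable_least_index (A := A).
  - rewrite (_ : A i = \bigcup_k (j @^-1` [set k] `&` [set y |
        F y `&` (O i n.+2 `&` O k n.+1) !=set0])).
      apply: bigcup_measurable => k _; apply: measurableI; first exact: mj.
      by apply: mF; apply: openI; exact: openO.
    by apply/seteqP; split=> [y Ay|y [k _ [<-]]]//; exists (j y).
  - have [x [Fx jx]] := Fj y; have [i xi] := denseO x n.+2.
    by exists i, x.
  exists j' => _; split; first split=> // y.
    by have [x [Fx [? _]]] := j'P y; exists x.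
  move=> y; have [x [Fx [/O_ball j'x /O_ball jx]]] := j'P y.
  rewrite -(halfS R n).
  apply: ball_triangle jx _; apply: (le_ball _ (ball_sym j'x)).
  by rewrite -(halfS R n.+1) lerDl ltW// half_gt0.
have /choice[s sP] := step.
pose j := fix j n := if n is m.+1 then s (m, j m) else j0.
have jP n : good n (j n) by elim: n => //= n /(sP (n, j n))[].
have jc y n : ball (u (j n y)) (half n) (u (j n.+1 y)).
  by have [_] := sP (n, j n) (jP n); exact.
have /choice[f fl] y := cX (jc y).
exists f; split=> [|y]; last first.
  suff : closure (F y) (f y) by apply: cF.
  move=> V /nbhs_ballP[e /= e0 eV]; have [n hn] := half_lt 4 e0.
  have [_ /(_ y)[x [Fx /O_ball jx]]] := jP n; exists x; split => //; apply: eV.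
  apply: (@le_ball _ _ _ (3 * half n + half n)).
    by rewrite -[X in _ + X]mul1r -mulrDl (_ : 3 + 1 = 4) ?ltW//; lra.
  apply: ball_triangle (ball_sym (rapid_tail n (jc y) (fl y))) _.
  by apply: le_ball jx; rewrite -(halfS R n) lerDl ltW// half_gt0.
(* As [f y] is at distance at most [3 * half n] from [u (j n y)], it lies in
   [U] iff, for some [n], a larger ball around [u (j n y)] does. *)
apply: (@measurability _ _ _ (borel X) _ _ (@open X)) => // _ [U oU <-].
rewrite setTI.
pose B n := [set i | ball (u i) (4 * half n) `<=` U].
rewrite (_ : _ @^-1` _ = \bigcup_n \bigcup_(i in B n) (j n @^-1` [set i])).
  apply: bigcup_measurable => n _; apply: bigcup_measurable => i _.
  by have [] := jP n.
apply/seteqP; split=> y /=.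
  move=> Uf; have /nbhs_ballP[e /= e0 eU] : nbhs (f y) U.
    exact: open_nbhs_nbhs.
  have [n hn] := half_lt 7 e0; exists n => //; exists (j n y) => // z uz.
  apply: eU; apply: (@le_ball _ _ _ (3 * half n + 4 * half n)).
    by rewrite -mulrDl (_ : 3 + 4 = 7) ?ltW//; lra.
  exact: ball_triangle (ball_sym (rapid_tail n (jc y) (fl y))) uz.
move=> [n _ [i Bi /= jn]]; apply: Bi; rewrite -jn.
apply: le_ball (rapid_tail n (jc y) (fl y)).
by rewrite ler_pM2r ?half_gt0// ler_nat.
Qed.

(** The selections are those of the correspondences obtained from [F] by
    replacing [F y] with the closure of its intersection with a small ball,
    wherever the intersection is not empty. *)
Lemma castaing_representation (F : Y -> set X) :
  (forall y, closed (F y)) -> (forall y, F y !=set0) -> weakly_measurable F ->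
  exists f : nat -> Y -> X,
    (forall n, @measurable_fun _ _ Y (borel X) setT (f n)) /\
    forall y, range (f ^~ y) `<=` F y /\ F y `<=` closure (range (f ^~ y)).
Proof.
move=> cF F0 mF.
pose B (ik : nat * nat) := O ik.1 ik.2.
have oB ik : open (B ik) by exact: openO.
pose G ik y := if `[< F y `&` B ik !=set0 >] then closure (F y `&` B ik)
  else F y.
have GF ik y : G ik y `<=` F y.
  rewrite /G; case: ifPn => _ // x /(closure_subset (@subIsetl _ _ _)).
  exact: cF.
have /choice[f fP] ik : exists f : Y -> X,
    @measurable_fun _ _ Y (borel X) setT f /\ forall y, G ik y (f y).
  apply: measurable_selection.
  - by move=> y; rewrite /G; case: ifP => _ //; exact: closed_closure.
  - move=> y; rewrite /G; case: ifPn => // /asboolP[x FBx].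
    by exists x; exact: subset_closure.
  - move=> U oU; rewrite (_ : [set y | _] =
      [set y | F y `&` (B ik `&` U) !=set0] `|`
      (~` [set y | F y `&` B ik !=set0] `&` [set y | F y `&` U !=set0])).
      apply: measurableU; first by apply: mF; exact: openI.
      by apply: measurableI; [apply: measurableC|]; exact: mF.
    apply/seteqP; split=> y /=; rewrite /G; case: asboolP => FB.
    + move=> [x [clx Ux]]; left; have [] := clx U; first exact: open_nbhs_nbhs.
      by move=> z [[Fz Bz] Uz]; exists z.
    + by move=> [x [Fx Ux]]; right; split => //; exists x.
    + move=> [|[/(_ FB)]]// [x [Fx [Bx Ux]]].
      by exists x; split => //; exact: subset_closure.
    + by move=> [[x [Fx [Bx Ux]]]|[_]]//; case: FB; exists x.
pose g n := f (odflt (0%N, 0%N) (unpickle n)).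
exists g; split=> [n|y]; first by have [] := fP (odflt (0%N, 0%N) (unpickle n)).
split=> [_ [n _ <-]|x Fx V /nbhs_ballP[e /= e0 eV]].
  by apply: GF; have [_] := fP (odflt (0%N, 0%N) (unpickle n)); exact.
have [k hk] := half_lt 3 e0; have [i uix] := denseO x k.
exists (g (pickle (i, k)) y); split; first by exists (pickle (i, k)).
apply: eV; rewrite /g pickleK/=.
have [_ /(_ y)] := fP (i, k); rewrite /G asboolT; last by exists x.
move=> /(_ _ (nbhsx_ballx _ _ (half_gt0 R k)))[z [[_ /O_ball uiz] fz]].
apply: (@le_ball _ _ _ (3 * half k)); first exact: ltW.
rewrite (_ : 3 * _ = half k + half k + half k); last by lra.
apply: ball_triangle (ball_sym fz).
exact: ball_triangle (ball_sym (O_ball uix)) uiz.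
Qed.

End selection.

(** * Integrals of bounded measurable functions *)

Section bounded_measurable.
Context d (T : measurableType d) (R : realType).
Implicit Types f g : T -> R.

(** Bounded measurable functions.  They are integrable for every probability
    measure, so this is the only side condition of the integration lemmas
    below. *)
Definition bounded_measurable f :=
  measurable_fun setT f /\ exists c, forall x, `|f x| <= c.

Lemma bounded_measurable_cst c : bounded_measurable (cst c).
Proof. by split; [exact: measurable_cst|exists `|c|]. Qed.

Lemma bounded_measurable_indic (A : set T) :
  measurable A -> bounded_measurable (\1_A).
Proof.
move=> mA; split; first exact: measurable_indic.
exists 1 => x; rewrite indicE; case: (_ \in _); rewrite ?normr1// normr0.
exact: ler01.
Qed.

Lemma bounded_measurableD f g : bounded_measurable f -> bounded_measurable g ->
  bounded_measurable (f \+ g).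
Proof.
move=> [mf [c fc]] [mg [e ge]]; split; first exact: measurable_funD.
by exists (c + e) => x; rewrite (le_trans (ler_normD _ _))// lerD.
Qed.

Lemma bounded_measurableN f : bounded_measurable f -> bounded_measurable (\- f).
Proof.
move=> [mf [c fc]]; split; first exact: measurableT_comp.
by exists c => x; rewrite normrN.
Qed.

Lemma bounded_measurableB f g : bounded_measurable f -> bounded_measurable g ->
  bounded_measurable (f \- g).
Proof.
by move=> bf bg; apply: (bounded_measurableD bf (bounded_measurableN bg)).
Qed.

Lemma bounded_measurableM f g : bounded_measurable f -> bounded_measurable g ->
  bounded_measurable (f \* g).
Proof.
move=> [mf [c fc]] [mg [e ge]]; split; first exact: measurable_funM.
by exists (c * e) => x; rewrite normrM ler_pM.
Qed.

Lemma bounded_measurableZ c f : bounded_measurable f ->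
  bounded_measurable (fun x => c * f x).
Proof. exact: (bounded_measurableM (bounded_measurable_cst c)). Qed.

Lemma bounded_measurable_norm f :
  bounded_measurable f -> bounded_measurable (fun x => `|f x|).
Proof.
move=> [mf [c fc]]; split; first exact: measurableT_comp.
by exists c => x; rewrite normr_id.
Qed.

Lemma bounded_measurable_sum (I : Type) (s : seq I) (F : I -> T -> R) :
  (forall i, bounded_measurable (F i)) ->
  bounded_measurable (fun x => \sum_(i <- s) F i x).
Proof.
move=> bF; elim: s => [|i s ih].
  under eq_fun do rewrite big_nil; exact: bounded_measurable_cst.
under eq_fun do rewrite big_cons; exact: bounded_measurableD.
Qed.

End bounded_measurable.

Section bounded_integral.
Context d (T : measurableType d) (R : realType).
Variables (mu : {measure set T -> \bar R}) (mu1 : mu setT = 1%E).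
Implicit Types f g h : T -> R.

Lemma bounded_measurable_integrable f :
  bounded_measurable f -> mu.-integrable setT (EFin \o f).
Proof.
move=> [mf [c fc]]; apply: measurable_bounded_integrable => //.
  by rewrite mu1 ltry.
exists c; split; first exact: num_real.
by move=> e ce x _; exact: le_trans (fc x) (ltW ce).
Qed.

Local Notation bm := bounded_measurable.
Local Notation bi := bounded_measurable_integrable.

Lemma bounded_integralD f g : bm f -> bm g ->
  \int[mu]_x (f x + g x) = \int[mu]_x f x + \int[mu]_x g x.
Proof. by move=> /bi ? /bi ?; rewrite RintegralD. Qed.

Lemma bounded_integralB f g : bm f -> bm g ->
  \int[mu]_x (f x - g x) = \int[mu]_x f x - \int[mu]_x g x.
Proof. by move=> /bi ? /bi ?; rewrite RintegralB. Qed.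

Lemma bounded_integralZ c f : bm f ->
  \int[mu]_x (c * f x) = c * \int[mu]_x f x.
Proof. by move=> /bi ?; rewrite RintegralZl. Qed.

Lemma bounded_integral_cst c : \int[mu]_(_ in setT) c = c.
Proof. by rewrite Rintegral_cst// mu1/= mulr1. Qed.

Lemma bounded_integral_le f g : bm f -> bm g -> (forall x, f x <= g x) ->
  \int[mu]_x f x <= \int[mu]_x g x.
Proof. by move=> /bi ? /bi ? fg; apply: le_Rintegral. Qed.

Lemma bounded_integral_norm f : bm f ->
  `|\int[mu]_x f x| <= \int[mu]_x `|f x|.
Proof. by move=> /bi ?; apply: le_normr_Rintegral. Qed.

Lemma bounded_integral_triangle f g h : bm f -> bm g -> bm h ->
  \int[mu]_x `|f x - h x| <=
  \int[mu]_x `|f x - g x| + \int[mu]_x `|g x - h x|.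
Proof.
move=> bf bg bh.
have bfg := bounded_measurable_norm (bounded_measurableB bf bg).
have bgh := bounded_measurable_norm (bounded_measurableB bg bh).
have bfh := bounded_measurable_norm (bounded_measurableB bf bh).
rewrite -bounded_integralD//; apply: bounded_integral_le => //.
  exact: bounded_measurableD.
by move=> x; exact: ler_distD.
Qed.

Lemma Rintegral_ae_eq f g : measurable_fun setT f -> measurable_fun setT g ->
  f = g %[ae mu] -> \int[mu]_x f x = \int[mu]_x g x.
Proof.
move=> mf mg fg; congr fine; apply: ae_eq_integral => //.
- exact/measurable_EFinP.
- exact/measurable_EFinP.
- by apply: filterS fg => x /= h /h ->.
Qed.

Lemma bounded_convergence (f_ : nat -> T -> R) f c :
  (forall n, measurable_fun setT (f_ n)) -> measurable_fun setT f ->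
  (forall n x, `|f_ n x| <= c) -> (forall x, `|f x| <= c) ->
  (\forall x \ae mu, f_ n x @[n --> \oo] --> f x) ->
  \int[mu]_x `|f_ n x - f x| @[n --> \oo] --> (0 : R).
Proof.
move=> mf_ mf f_c fc f_f.
have [] := @dominated_convergence _ _ _ mu setT measurableT
  (fun n x => (f_ n x)%:E) (EFin \o f) (cst c%:E).
- by move=> n; apply/measurable_EFinP.
- exact/measurable_EFinP.
- by apply: filterS f_f => x fx _; apply: cvg_EFin => //; apply: nearW.
- apply: (@bounded_measurable_integrable (cst c)).
  exact: bounded_measurable_cst.
- by apply: aeW => x n _ /=; rewrite lee_fin.
move=> _ h _; have : fine (\int[mu]_x `|(f_ n x)%:E - (f x)%:E|%E)%E
    @[n --> \oo] --> fine (0%:E : \bar R).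
  exact: fine_cvg h.
by [].
Qed.

End bounded_integral.

(** * Countably generated sigma-algebras *)

Section countably_generated.

(** The sigma-algebra is generated by a sequence of measurable sets. *)
Definition countably_generated d (T : measurableType d) :=
  exists2 G : nat -> set T, forall n, measurable (G n) &
    measurable `<=` <<s range G >>.

Lemma standard_borel_countably_generated (R : realType) d
    (T : measurableType d) : standard_borel R T -> countably_generated T.
Proof.
move=> [S [f [_ [B cB [Bo Bnbhs]] bf mf]]].
have fK A : f @` (f @^-1` A) = A.
  have [g fg gf] := bf; apply/seteqP; split=> [_ [x ? <-]//|y Ay].
  by exists (g y); rewrite /= gf.
have Kf A : f @^-1` (f @` A) = A.
  apply/seteqP; split=> [x [y Ay /(bij_inj bf) <-]//|x Ax]; by exists x.
have /countable_injP[c cinj] := cB.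
pose e n : set S := xget set0 [set b | B b /\ c b = n].
have eB b : B b -> e (c b) = b.
  move=> Bb; rewrite /e; case: xgetP => [b' _ [Bb' cb]|/(_ b)[]//].
  by apply: cinj => //; exact/mem_set.
have eo n : open (e n).
  by rewrite /e; case: xgetP => [b' _ [/Bo]//|_]; exact: open0.
exists (fun n => f @^-1` e n) => [n|A /mf mA].
  by apply/mf; rewrite fK; exact: sub_sigma_algebra.
pose M := <<s range (fun n => f @^-1` e n)>>.
have sM : sigma_algebra setT (image_set_system setT f M).
  exact/sigma_algebra_image/smallest_sigma_algebra.
have : image_set_system setT f M (f @` A).
  apply: (smallest_sub sM _ mA) => U oU.
  rewrite (_ : U = \bigcup_n (if `[< e n `<=` U >] then e n else set0)).
    have [_ _] := sM; apply => n; case: ifPn => _.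
      rewrite /image_set_system/= setTI; apply: sub_sigma_algebra.
      by exists n.
    by have [] := sM.
  apply/seteqP; split=> [x Ux|x [n _]]; last by case: asboolP => // + ?; exact.
  have /Bnbhs[b [Bb bx] bU] : nbhs x U by exact: open_nbhs_nbhs.
  by exists (c b) => //; rewrite eB// asboolT.
by rewrite /image_set_system/= setTI Kf.
Qed.

Lemma countably_generated_prod d1 (T1 : measurableType d1) d2
    (T2 : measurableType d2) : countably_generated T1 ->
  countably_generated T2 -> countably_generated (T1 * T2)%type.
Proof.
move=> [G1 mG1 G1s] [G2 mG2 G2s].
pose G n : set (T1 * T2) :=
  if odd n then fst @^-1` G1 n./2 else snd @^-1` G2 n./2.
have mfst := @measurable_fst _ _ T1 T2.
have msnd := @measurable_snd _ _ T1 T2.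
exists G => [n|].
  rewrite /G; case: ifP => _; rewrite -[X in measurable X]setTI.
    exact: mfst.
  exact: msnd.
have sM : sigma_algebra setT <<s range G>> by exact: smallest_sigma_algebra.
rewrite measurable_prod_measurableType; apply: smallest_sub => //.
move=> _ [A mA [B mB <-]].
have -> : A `*` B = (fst @^-1` A) `&` (snd @^-1` B) by [].
have sI C D : <<s range G>> C -> <<s range G>> D -> <<s range G>> (C `&` D).
  move=> sC sD; rewrite -[C `&` D]setCK setCI -bigcup2E -setTD.
  have [s0 sD' sU] := sM; apply: (sD'); apply: sU => -[|[|n]] //=.
  - by rewrite -setTD; exact: sD'.
  - by rewrite -setTD; exact: sD'.
apply: sI.
- have := smallest_sub (sigma_algebra_image fst sM) _ (G1s _ mA).
  rewrite /image_set_system/= setTI; apply => _ [n _ <-].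
  rewrite /image_set_system/= setTI; apply: sub_sigma_algebra.
  by exists n.*2.+1 => //; rewrite /G/= odd_double/= uphalf_double.
- have := smallest_sub (sigma_algebra_image snd sM) _ (G2s _ mB).
  rewrite /image_set_system/= setTI; apply => _ [n _ <-].
  rewrite /image_set_system/= setTI; apply: sub_sigma_algebra.
  by exists n.*2 => //; rewrite /G/= odd_double/= half_double.
Qed.

(** Boolean combinations of the sets [G i], coded by trees with natural numbers
    at their leaves: a node with one child is a complement, a node with two
    children a union; other nodes denote the empty set. *)
Fixpoint boolean_set T (G : nat -> set T) (t : GenTree.tree nat) : set T :=
  match t with
  | GenTree.Leaf i => G i
  | GenTree.Node _ [:: a] => ~` boolean_set G a
  | GenTree.Node _ [:: a; b] => boolean_set G a `|` boolean_set G b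
  | _ => set0
  end.

(** An enumeration of the boolean algebra generated by the sets [G i]. *)
Definition boolean_sets T (G : nat -> set T) (n : nat) : set T :=
  oapp (boolean_set G) set0 (unpickle n).

Lemma boolean_sets_pickle T (G : nat -> set T) t :
  boolean_sets G (pickle t) = boolean_set G t.
Proof. by rewrite /boolean_sets pickleK. Qed.

Lemma boolean_setsP T (G : nat -> set T) n :
  exists t, boolean_sets G n = boolean_set G t.
Proof.
rewrite /boolean_sets; case: unpickle => [t|]; first by exists t.
by exists (GenTree.Node 0 [::]).
Qed.

Lemma measurable_boolean_sets d (T : measurableType d) (G : nat -> set T) n :
  (forall n, measurable (G n)) -> measurable (boolean_sets G n).
Proof.
move=> mG; have [t ->] := boolean_setsP G n.
move: t; fix ih 1 => -[i|k [|a [|b [|? ?]]]] /=.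
- exact: mG.
- exact: measurable0.
- exact/measurableC/ih.
- by apply: measurableU; exact: ih.
- exact: measurable0.
Qed.

End countably_generated.

(** * Approximation of measurable sets and functions *)

Section approximation.
Context d (T : measurableType d) (R : realType).
Variables (mu : {measure set T -> \bar R}) (mu1 : mu setT = 1%E).

Local Notation dist1 f g := (\int[mu]_x `|f x - g x|).

Lemma indic_bigcup_cvg (A : nat -> set T) :
  (forall n, measurable (A n)) ->
  dist1 (\1_(\big[setU/set0]_(i < n) A i) : T -> R) (\1_(\bigcup_i A i))
    @[n --> \oo] --> (0 : R).
Proof.
move=> mA; apply: (bounded_convergence mu1 (c := 1)).
- by move=> n; apply: measurable_indic; exact: bigsetU_measurable.
- by apply: measurable_indic; exact: bigcup_measurable.
- by move=> n x; rewrite indicE; case: (_ \in _); rewrite ?normr1// normr0.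
- by move=> x; rewrite indicE; case: (_ \in _); rewrite ?normr1// normr0.
apply: aeW => x; have [[k _ Ax]|nA] := pselect ((\bigcup_i A i) x).
  apply: cvg_near_cst; exists k.+1 => // n /= kn.
  rewrite !indicE !mem_set//; first by exists k.
  by rewrite -bigcup_mkord; exists k.
apply: cvg_near_cst; apply: nearW => n; rewrite !indicE !memNset//.
by rewrite -bigcup_mkord => -[k _ Ak]; apply: nA; exists k.
Qed.

(** The generated sigma-algebra is the closure, for the measure of symmetric
    differences, of the boolean algebra: the sets that this algebra
    approximates form a sigma-algebra. *)
Lemma boolean_sets_dense (G : nat -> set T) (E : set T) (e : R) :
  (forall n, measurable (G n)) -> <<s range G>> E -> 0 < e ->
  exists n, dist1 (\1_E) (\1_(boolean_sets G n)) < e.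
Proof.
move=> mG sE; move: e.
pose C := boolean_sets G.
have mC n : measurable (C n) by exact: measurable_boolean_sets.
have bI A : measurable A -> bounded_measurable (\1_A : T -> R).
  exact: bounded_measurable_indic.
pose M := [set A | measurable A /\
  forall e, 0 < e -> exists n, dist1 (\1_A) (\1_(C n)) < e].
suff : M E by case.
have d0 A : dist1 (\1_A) (\1_A) = 0.
  under eq_Rintegral do rewrite subrr normr0.
  by rewrite bounded_integral_cst.
have MC n : M (C n) by split=> // e e0; exists n; rewrite d0.
have M0 : M set0.
  have := MC (pickle (GenTree.Node 0 [::] : GenTree.tree nat)).
  by rewrite /C boolean_sets_pickle.
have MU A B : M A -> M B -> M (A `|` B).
  move=> [mA hA] [mB hB]; split=> [|e e0]; first exact: measurableU.
  have e20 : 0 < e / 2 by rewrite divr_gt0.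
  have [i Ai] := hA _ e20; have [j Bj] := hB _ e20.
  have [s si] := boolean_setsP G i; have [t tj] := boolean_setsP G j.
  exists (pickle (GenTree.Node 0 [:: s; t])).
  rewrite /C boolean_sets_pickle/= -si -tj -/(C i) -/(C j) (splitr e).
  apply: le_lt_trans (ltrD Ai Bj); rewrite -bounded_integralD//; last 2 first.
    by apply/bounded_measurable_norm/bounded_measurableB; exact: bI.
    by apply/bounded_measurable_norm/bounded_measurableB; exact: bI.
  apply: bounded_integral_le => //.
  - by apply/bounded_measurable_norm/bounded_measurableB; apply: bI => //;
      exact: measurableU.
  - by apply: bounded_measurableD;
      apply/bounded_measurable_norm/bounded_measurableB; exact: bI.
  move=> x; rewrite !indicE !in_setU.
  by case: (x \in A); case: (x \in B); case: (x \in C i); case: (x \in C j);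
    rewrite /= ?subr0 ?sub0r ?normrN ?subrr ?normr0 ?normr1 ?addr0 ?add0r;
    rewrite ?lexx ?ler01// -[X in X <= _]addr0 lerD2l ler01.
apply: (smallest_sub (C := sigma_algebra setT) _ _ sE); last first.
  move=> _ [i _ <-]; have := MC (pickle (GenTree.Leaf i)).
  by rewrite /C boolean_sets_pickle.
split=> // [A [mA hA]|A MA].
  rewrite setTD; split=> [|e e0]; first exact: measurableC.
  have [i Ai] := hA _ e0; have [s si] := boolean_setsP G i.
  exists (pickle (GenTree.Node 0 [:: s])).
  rewrite /C boolean_sets_pickle/= -si -/(C i).
  apply: le_lt_trans Ai; rewrite le_eqVlt; apply/orP; left; apply/eqP.
  apply: eq_Rintegral => x _; rewrite !indicE !in_setC distrC.
  by case: (x \in A); case: (x \in C i) => /=; rewrite ?subrr.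
have mA n : measurable (A n) by case: (MA n).
have mU : measurable (\bigcup_i A i) by exact: bigcup_measurable.
split=> // e e0.
have e20 : 0 < e / 2 by rewrite divr_gt0.
have Mfin n : M (\big[setU/set0]_(i < n) A i).
  elim: n => [|n ih]; first by rewrite big_ord0.
  by rewrite big_ord_recr/=; exact: MU.
have /cvgrPdist_lt/(_ _ e20)[n _ /(_ n (leqnn _))] := indic_bigcup_cvg mA.
have [mn /(_ _ e20)[k nk]] := Mfin n.
rewrite sub0r normrN => hn; exists k; rewrite (splitr e).
apply: le_lt_trans (bounded_integral_triangle mu1 (bI _ mU) (bI _ mn)
  (bI _ (mC k))) _.
apply: ltrD nk; apply: le_lt_trans hn; apply: le_trans (ler_norm _).
by under eq_Rintegral do rewrite distrC.
Qed.

(** The sum counts the integers between 1 and [N] that are at most [y]: it is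
    [y] rounded down, truncated at [N]. *)
Lemma layer_sum (N : nat) (y : R) : 0 <= y ->
  [/\ \sum_(i < N) (i.+1%:R <= y)%R%:R <= y,
      y <= N%:R -> y <= \sum_(i < N) (i.+1%:R <= y)%R%:R + 1 &
      N%:R <= y -> \sum_(i < N) (i.+1%:R <= y)%R%:R = N%:R :> R].
Proof.
move=> y0; elim: N => [|N [h1 h2 h3]].
  rewrite big_ord0; split=> // yN.
  by rewrite add0r (le_trans yN).
rewrite big_ord_recr/=; have NS : N.+1%:R = N%:R + 1 :> R by rewrite natr1.
rewrite NS; have [yN|yN] := leP (N%:R + 1) y.
  rewrite h3/=; last by lra.
  by split=> // yN'; lra.
rewrite addr0; split=> // _.
have [/h2//|Ny] := leP y N%:R.
by rewrite h3; lra.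
Qed.

(** The superlevel set of [u] at [i.+1 / N]; when [u] takes its values in
    [0, 1], the average of the indicators of the first [N] of them is [u]
    rounded down to a multiple of [1 / N]. *)
Definition layers (u : T -> R) N (i : nat) : set T :=
  [set x | i.+1%:R <= N%:R * u x].

Lemma measurable_layers u N i : measurable_fun setT u ->
  measurable (layers u N i).
Proof.
move=> mu'; have mNu : measurable_fun setT (fun x => N%:R * u x).
  exact: measurable_funM.
rewrite (_ : layers u N i = (fun x => N%:R * u x) @^-1` `[i.+1%:R, +oo[).
  by rewrite -[X in measurable X]setTI; exact: mNu.
by apply/seteqP; split=> x /=; rewrite in_itv/= andbT.
Qed.

Lemma layers_approx u N x : (0 < N)%N -> 0 <= u x <= 1 ->
  `|u x - N%:R^-1 * \sum_(i < N) \1_(layers u N i) x| <= N%:R^-1.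
Proof.
move=> N0 /andP[u0 u1]; have N0' : 0 < N%:R :> R by rewrite ltr0n.
rewrite (eq_bigr (fun i : 'I_N => (i.+1%:R <= N%:R * u x)%R%:R)); last first.
  move=> i _; rewrite indicE; congr (_%:R); congr nat_of_bool.
  by apply/idP/idP => [/set_mem//|h]; exact/mem_set.
have [|h1 + _] := @layer_sum N (N%:R * u x); first by rewrite mulr_ge0// ltW.
rewrite ler_piMr ?(ltW N0')// => /(_ isT) h2.
rewrite -[X in X - _](mulKf (lt0r_neq0 N0')) -mulrBr normrM.
rewrite [X in X * _]ger0_norm ?invr_ge0 ?(ltW N0')//.
rewrite -[X in _ <= X]mulr1 ler_pM2l ?invr_gt0// ger0_norm ?subr_ge0//.
by rewrite lerBlDl.
Qed.

End approximation.

(** * Pointwise representatives of graphons *)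

Section graphon_functions.
Context d (Omega : measurableType d) (R : realType) (P : probability Omega R).
Local Notation PP := (P \x P)%E.
Local Notation OO := (Omega * Omega)%type.
Implicit Types (u v : OO -> R) (w : graphon P).

Lemma product_probability_setT : PP [set: OO] = 1%E.
Proof.
rewrite -setXTT product_measure1E//.
by have /= -> := @probability_setT _ _ _ P; rewrite mule1.
Qed.
Local Notation PP1 := product_probability_setT.

(** A pointwise graphon: a symmetric measurable function with values in
    [0, 1]. *)
Definition kernel u := [/\ measurable_fun setT u,
  forall x y, u (x, y) = u (y, x) & forall z, 0 <= u z <= 1].

Lemma kernel_bounded u : kernel u -> bounded_measurable u.
Proof.
move=> [mu _ u01]; split=> //; exists 1 => z.
by have /andP[u0 u1] := u01 z; rewrite ger0_norm.
Qed.

Lemma graphon_of_kernel u : kernel u ->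
  exists w, (w : _ -> R) = u %[ae PP].
Proof.
move=> ku; have [mu us u01] := ku.
pose f : {mfun OO >-> measurableTypeR R} :=
  HB.pack u (isMeasurableFun.Build _ _ OO (measurableTypeR R) u mu).
pose c : {mfun_ PP, OO >-> measurableTypeR R} :=
  \pi_({mfun_ PP, OO >-> measurableTypeR R}) f.
have fc : (u : _ -> R) = (c : _ -> R) %[ae PP].
  suff : ae_eq_op PP f (repr c) by move/asboolP.
  by rewrite -eqmodE reprK.
have iu := bounded_measurable_integrable PP1 (kernel_bounded ku).
have cfin : finite_norm PP 1 c.
  rewrite /finite_norm Lnorm1 (ae_eq_integral (fun z => `|(u z)%:E|%E))//.
  - by have /integrableP[] := iu.
  - apply: measurableT_comp => //; apply/measurable_EFinP.
    exact: (@measurable_funPT _ _ _ _ (repr c)).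
  - by apply: measurableT_comp => //; exact/measurable_EFinP.
  - by apply: filterS fc => z /= + h => /(_ h) ->.
pose L : LspaceType1 PP :=
  HB.pack c (isFinLebesgue.Build _ _ _ _ _ _ _ cfin).
pose f' : {mfun OO >-> R} := HB.pack u (isMeasurableFun.Build _ _ OO R u mu).
have gL : is_graphon L by exists f'; split.
exists (exist _ L gL); by apply: filterS fc => z h hz; rewrite h.
Qed.

Lemma graphon_kernel w :
  exists u, kernel u /\ (w : _ -> R) = u %[ae PP].
Proof.
have [u [uw us u01]] := svalP w; exists u; split; first by split.
by apply: filterS uw => z h /h.
Qed.

(** A representative of a graphon that is symmetric and [0, 1]-valued at every
    point; the representative chosen by the quotient is so only almost
    everywhere. *)
Definition graphon_rep w : OO -> R := sval (cid (graphon_kernel w)).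

Lemma graphon_rep_kernel w : kernel (graphon_rep w).
Proof. by rewrite /graphon_rep; case: cid => u []. Qed.

Lemma graphon_rep_ae w : (w : _ -> R) = graphon_rep w %[ae PP].
Proof. by rewrite /graphon_rep; case: cid => u []. Qed.

Lemma graphon_rep_of_ae w u : (w : _ -> R) = u %[ae PP] ->
  graphon_rep w = u %[ae PP].
Proof.
by apply: filterS2 (graphon_rep_ae w) => z h h' hz; rewrite -h// h'.
Qed.

Lemma L1_distE w w' :
  L1_dist w w' = \int[PP]_z `|graphon_rep w z - graphon_rep w' z|.
Proof.
have [m _ _] := graphon_rep_kernel w; have [m' _ _] := graphon_rep_kernel w'.
apply: Rintegral_ae_eq.
- apply: measurableT_comp => //; apply: measurable_funB;
    exact: measurable_graphon.
- by apply: measurableT_comp => //; exact: measurable_funB.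
- apply: filterS2 (graphon_rep_ae w) (graphon_rep_ae w') => z h h' hz.
  by rewrite h// h'.
Qed.

Lemma Rintegral_setX u S T : measurable S -> measurable T ->
  \int[PP]_(z in S `*` T) u z = \int[PP]_z (u z * \1_(S `*` T) z).
Proof.
move=> mS mT; rewrite Rintegral_mkcond; apply: eq_Rintegral => z _.
by rewrite patchE indicE; case: ifP; rewrite ?mulr1 ?mulr0.
Qed.

Lemma cut_norm_le u c : (forall S T, measurable S -> measurable T ->
  `|\int[PP]_z (u z * \1_(S `*` T) z)| <= c) -> cut_norm P u <= c.
Proof.
move=> h; apply: ge_sup => [|_ [S [T [mS mT ->]]]].
  by exists `|\int[PP]_(z in set0 `*` set0) u z|, set0, set0.
by rewrite Rintegral_setX//; exact: h.
Qed.

Lemma bounded_integral_indic_le u E : bounded_measurable u -> measurable E ->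
  `|\int[PP]_z (u z * \1_E z)| <= \int[PP]_z `|u z|.
Proof.
move=> bu mE; have bE := bounded_measurable_indic R mE.
have buE := bounded_measurableM bu bE.
apply: (le_trans (bounded_integral_norm PP1 buE)).
apply: (bounded_integral_le PP1) => [| |z].
- exact: bounded_measurable_norm.
- exact: bounded_measurable_norm.
- rewrite normrM ler_piMr// indicE.
  by case: (_ \in _); rewrite ?normr1// normr0 ler01.
Qed.

(** The cut norm is bounded by the L1 norm. *)
Lemma cut_norm_le_L1 u : bounded_measurable u ->
  cut_norm P u <= \int[PP]_z `|u z|.
Proof.
move=> bu; apply: cut_norm_le => S T mS mT.
by apply: bounded_integral_indic_le => //; exact: measurableX.
Qed.

Lemma cut_norm_ub u S T : bounded_measurable u ->
  measurable S -> measurable T ->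
  `|\int[PP]_z (u z * \1_(S `*` T) z)| <= cut_norm P u.
Proof.
move=> bu mS mT; apply: ub_le_sup.
  exists (\int[PP]_z `|u z|) => _ [A [B [mA mB ->]]].
  rewrite Rintegral_setX//.
  by apply: bounded_integral_indic_le => //; exact: measurableX.
by exists S, T; split=> //; rewrite Rintegral_setX.
Qed.

Lemma cut_norm_ae_eq u v : measurable_fun setT u -> measurable_fun setT v ->
  u = v %[ae PP] -> cut_norm P u = cut_norm P v.
Proof.
move=> mu mv uv; rewrite /cut_norm; congr sup; apply/seteqP.
have h S T : measurable S -> measurable T ->
    \int[PP]_(z in S `*` T) u z = \int[PP]_(z in S `*` T) v z.
  move=> mS mT; rewrite !Rintegral_setX//; apply: Rintegral_ae_eq.
  - apply: measurable_funM => //; apply: measurable_indic.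
    exact: measurableX.
  - apply: measurable_funM => //; apply: measurable_indic.
    exact: measurableX.
  - by apply: filterS uv => z uvz hz; rewrite uvz.
by split=> _ [S [T [mS mT ->]]]; exists S, T; split; rewrite ?h.
Qed.

(** [relabel u psi] is the composition of [u] with this map. *)
Definition product_map (psi : Omega -> Omega) (z : OO) := (psi z.1, psi z.2).

Lemma measurable_product_map psi :
  measurable_fun setT psi -> measurable_fun setT (product_map psi).
Proof.
move=> mpsi; apply: measurable_fun_pair => /=.
- by apply: (measurableT_comp mpsi); exact: measurable_fst.
- by apply: (measurableT_comp mpsi); exact: measurable_snd.
Qed.

Lemma product_map_preserving psi A : invertible_mpt P psi -> measurable A ->
  PP (product_map psi @^-1` A) = PP A.
Proof.
move=> [mpsi _ Ppsi] mA; have mpp := measurable_product_map mpsi.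
pose m' : {measure set _ -> \bar R} :=
  @measure_function_pushforward__canonical__measure_function_Measure
    _ _ _ _ _ PP _ mpp.
rewrite -[LHS]/(m' A) (@product_measure_unique _ _ _ _ _ P P m')// => B C mB mC.
rewrite /m'/= /pushforward.
have -> : product_map psi @^-1` (B `*` C) = (psi @^-1` B) `*` (psi @^-1` C).
  by [].
have mpre D : measurable D -> measurable (psi @^-1` D).
  by move=> mD; rewrite -[X in measurable X]setTI; exact: mpsi.
rewrite product_measure1E; [|exact: mpre..].
by congr (_ * _)%E; exact: Ppsi.
Qed.

Lemma relabel_measurable u psi : invertible_mpt P psi ->
  measurable_fun setT u -> measurable_fun setT (relabel u psi).
Proof.
move=> [mpsi _ _] mu; apply: (measurableT_comp mu).
exact: measurable_product_map.
Qed.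

Lemma relabel_kernel u psi : invertible_mpt P psi ->
  kernel u -> kernel (relabel u psi).
Proof.
move=> ipsi [mu us u01]; split=> [|x y|z]; first exact: relabel_measurable.
- by rewrite /relabel us.
- exact: u01.
Qed.

Lemma relabel_ae_eq u v psi : invertible_mpt P psi ->
  u = v %[ae PP] -> relabel u psi = relabel v psi %[ae PP].
Proof.
move=> ipsi [N [mN N0 uvN]]; have [mpsi _ _] := ipsi.
have mpp := measurable_product_map mpsi.
exists (product_map psi @^-1` N); split.
- by rewrite -[X in measurable X]setTI; exact: mpp.
- by rewrite product_map_preserving.
- move=> z hz; apply: uvN => /= h; apply: hz => _; exact: h.
Qed.

Lemma relabel_integral u psi : invertible_mpt P psi -> bounded_measurable u ->
  \int[PP]_z relabel u psi z = \int[PP]_z u z.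
Proof.
move=> ipsi bu; have [mpsi _ _] := ipsi; have [mu _] := bu.
have mpp := measurable_product_map mpsi.
congr fine; rewrite -[RHS](@eq_measure_integral _ _ _ _ _
    (@measure_function_pushforward__canonical__measure_function_Measure
       _ _ _ _ _ PP _ mpp)); last first.
  by move=> A mA _; exact: product_map_preserving.
have mEu : measurable_fun setT (EFin \o u) by exact/measurable_EFinP.
rewrite [RHS](integral_pushforward mpp mEu)//=.
have [mr [c rc]] : bounded_measurable (relabel u psi).
  have [_ [c uc]] := bu; split; first exact: relabel_measurable.
  by exists c => z; exact: uc.
apply: (bounded_measurable_integrable PP1); split=> //; by exists c.
Qed.

Lemma cut_norm_rep w w' psi : invertible_mpt P psi ->
  cut_norm P (relabel w psi \- w') =
  cut_norm P (relabel (graphon_rep w) psi \- graphon_rep w').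
Proof.
move=> ipsi; have [m _ _] := graphon_rep_kernel w.
have [m' _ _] := graphon_rep_kernel w'.
apply: cut_norm_ae_eq.
- apply: measurable_funB; last exact: measurable_graphon.
  by apply: relabel_measurable => //; exact: measurable_graphon.
- by apply: measurable_funB => //; exact: relabel_measurable.
- apply: filterS2 (relabel_ae_eq ipsi (graphon_rep_ae w)) (graphon_rep_ae w').
  by move=> z h h' hz /=; rewrite h// h'.
Qed.

Lemma cut_dist_le w w' psi : invertible_mpt P psi -> cut_dist w w' <=
  \int[PP]_z `|relabel (graphon_rep w) psi z - graphon_rep w' z|.
Proof.
move=> ipsi.
have b' := kernel_bounded (graphon_rep_kernel w').
have bB psi' : invertible_mpt P psi' ->
    bounded_measurable (relabel (graphon_rep w) psi' \- graphon_rep w').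
  move=> ipsi'; apply: bounded_measurableB => //.
  exact/kernel_bounded/relabel_kernel/graphon_rep_kernel.
apply: le_trans (cut_norm_le_L1 (bB _ ipsi)); rewrite -cut_norm_rep//.
apply: ge_inf; last by exists psi.
exists 0 => _ [psi' ipsi' <-]; rewrite cut_norm_rep//.
by apply: le_trans (cut_norm_ub (bB _ ipsi') measurable0 measurable0).
Qed.

Lemma cut_dist_ltP w w' e : cut_dist w w' < e -> exists2 psi,
  invertible_mpt P psi &
  cut_norm P (relabel (graphon_rep w) psi \- graphon_rep w') < e.
Proof.
move=> we; have /inf_lt h := we.
have [|_ [psi ipsi <-] h'] := h.
  exists (cut_norm P (relabel w id \- w')), id => //.
  by split=> //; exists id; split.
by exists psi => //; rewrite -cut_norm_rep.
Qed.

End graphon_functions.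

(** * Cut norm and weak convergence *)

Section cut_continuous.
Context d (Omega : measurableType d) (R : realType) (P : probability Omega R).
Local Notation PP := (P \x P)%E.
Local Notation OO := (Omega * Omega)%type.
Local Notation PP1 := (product_probability_setT P).
Implicit Types (u v : OO -> R) (w : graphon P).

(** Integration against [v] is continuous at 0, for the cut norm, on the unit
    ball of the bounded functions. *)
Definition cut_continuous v := bounded_measurable v /\
  forall e : R, 0 < e -> exists2 r : R, 0 < r &
    forall u, measurable_fun setT u -> (forall z, `|u z| <= 1) ->
      cut_norm P u < r -> `|\int[PP]_z (u z * v z)| < e.

Lemma cut_continuous_setX S T : measurable S -> measurable T ->
  cut_continuous (\1_(S `*` T)).
Proof.
move=> mS mT; split.
  by apply: bounded_measurable_indic; exact: measurableX.
move=> e e0; exists e => // u mu u1; apply: le_lt_trans.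
by apply: cut_norm_ub => //; split=> //; exists 1.
Qed.

Lemma cut_continuous_lim v : bounded_measurable v ->
  (forall e : R, 0 < e -> exists2 v', cut_continuous v' &
     \int[PP]_z `|v z - v' z| < e) -> cut_continuous v.
Proof.
move=> bv hv; split=> // e e0; have e20 : 0 < e / 2 by rewrite divr_gt0.
have [v' [bv' hv'] vv'] := hv _ e20; have [r r0 hr] := hv' _ e20.
exists r => // u mu u1 ur; have bu : bounded_measurable u.
  by split=> //; exists 1.
have bB := bounded_measurableB bv bv'.
have -> : \int[PP]_z (u z * v z) =
    \int[PP]_z (u z * v' z) + \int[PP]_z (u z * (v z - v' z)).
  rewrite -(bounded_integralD PP1); last 2 first.
  - exact: bounded_measurableM.
  - exact: bounded_measurableM bu bB.
  by apply: eq_Rintegral => z _; rewrite -mulrDr addrC subrK.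
rewrite (splitr e) (le_lt_trans (ler_normD _ _))// ltrD//.
  exact: hr.
apply: le_lt_trans vv'.
apply: le_trans (bounded_integral_norm PP1 (bounded_measurableM bu bB)) _.
apply: (bounded_integral_le PP1).
- exact/bounded_measurable_norm/(bounded_measurableM bu bB).
- exact/bounded_measurable_norm.
- by move=> z; rewrite normrM ler_piMl.
Qed.

Lemma cut_continuousD v v' : cut_continuous v -> cut_continuous v' ->
  cut_continuous (v \+ v').
Proof.
move=> [bv hv] [bv' hv']; split; first exact: bounded_measurableD.
move=> e e0; have e20 : 0 < e / 2 by rewrite divr_gt0.
have [r r0 hr] := hv _ e20; have [r' r'0 hr'] := hv' _ e20.
exists (Num.min r r'); first by rewrite lt_min r0.
move=> u mu u1; rewrite lt_min => /andP[ur ur'].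
have bu : bounded_measurable u by split=> //; exists 1.
under eq_Rintegral do rewrite /= mulrDr.
rewrite (bounded_integralD PP1); try exact: bounded_measurableM.
rewrite (splitr e) (le_lt_trans (ler_normD _ _))// ltrD//.
- exact: hr.
- exact: hr'.
Qed.

Lemma cut_continuousZ c v :
  cut_continuous v -> cut_continuous (fun z => c * v z).
Proof.
move=> [bv hv]; split; first exact: bounded_measurableZ.
move=> e e0; have c0 : 0 < `|c| + 1 by rewrite ltr_wpDl.
have [|r r0 hr] := hv (e / (`|c| + 1)); first by rewrite divr_gt0.
exists r => // u mu u1 /(hr _ mu u1) h.
under eq_Rintegral do rewrite mulrCA.
rewrite (bounded_integralZ PP1); last first.
  by apply: bounded_measurableM => //; split=> //; exists 1.
rewrite normrM; move: h; rewrite ltr_pdivlMr//; apply: le_lt_trans.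
by rewrite mulrC ler_wpM2l// lerDl.
Qed.

Lemma cut_continuousB v v' : cut_continuous v -> cut_continuous v' ->
  cut_continuous (v \- v').
Proof.
move=> hv /(cut_continuousZ (-1)) hv'.
rewrite (_ : v \- v' = v \+ (fun z => -1 * v' z)); first exact: cut_continuousD.
by apply/funext => z /=; rewrite mulN1r.
Qed.

Lemma cut_continuous_indic (E : set OO) :
  measurable E -> cut_continuous (\1_E).
Proof.
have mG := measurable_prod_measurableType Omega Omega.
rewrite [X in X E -> _]mG.
apply: (@dynkin_induction _ _ _ (fun S => cut_continuous (\1_S)) mG).
- move=> _ _ [A mA [B mB <-]] [C mC [D mD <-]].
  by rewrite -setXI; exists (A `&` C); [exact: measurableI|
    exists (B `&` D) => //; exact: measurableI].
- by rewrite -setXTT; exact: cut_continuous_setX.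
- by move=> _ [A mA [B mB <-]]; exact: cut_continuous_setX.
- move=> S mS hS; rewrite (_ : \1_(~` S) = \1_setT \- \1_S :> (OO -> R)).
    apply: cut_continuousB => //; rewrite -setXTT.
    exact: cut_continuous_setX.
  apply/funext => z /=; rewrite !indicE in_setC in_setT.
  by case: (z \in S); rewrite /= ?subrr ?subr0.
- move=> F mF tF hF; apply: cut_continuous_lim.
    by apply: bounded_measurable_indic; exact: bigcup_measurable.
  move=> e e0.
  have /cvgrPdist_lt/(_ _ e0)[n _ /(_ n (leqnn _))] := indic_bigcup_cvg PP1 mF.
  rewrite sub0r normrN => hn; exists (\1_(\big[setU/set0]_(i < n) F i)).
    elim: n {hn} => [|n ih].
      rewrite big_ord0 -(set0X (set0 : set Omega)).
      exact: cut_continuous_setX.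
    rewrite big_ord_recr/=.
    rewrite (_ : \1_(_ `|` _) = \1_(\big[setU/set0]_(i < n) F i) \+ \1_(F n)).
      exact: cut_continuousD.
    apply/funext => z /=; rewrite !indicE in_setU.
    case: (boolP (z \in F n)) => zn; last by rewrite orbF addr0.
    rewrite memNset ?add0r//= -bigcup_mkord => -[k /= kn Fk].
    have kn' : k = n by apply: tF => //; exists z; split=> //; exact: set_mem.
    by rewrite kn' ltnn in kn.
  apply: le_lt_trans hn; apply: le_trans (ler_norm _).
  by under eq_Rintegral do rewrite distrC.
Qed.

Lemma invr_nat_lt (e : R) : 0 < e -> exists2 N, (0 < N)%N & N%:R^-1 < e.
Proof.
move=> e0; exists (Num.truncn e^-1).+1 => //.
by rewrite invf_plt ?posrE//; exact: truncnS_gt.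
Qed.

Lemma layers_approx_L1 u N : (0 < N)%N -> kernel u ->
  \int[PP]_z `|u z - N%:R^-1 * \sum_(i < N) \1_(layers u N i) z| <= N%:R^-1.
Proof.
move=> N0 ku; have [mu _ u01] := ku.
have bs : bounded_measurable
    (fun z => N%:R^-1 * \sum_(i < N) \1_(layers u N i) z : R).
  apply: bounded_measurableZ.
  apply: bounded_measurable_sum => i.
  by apply: bounded_measurable_indic; exact: measurable_layers.
rewrite -[leRHS](bounded_integral_cst PP1).
apply: (bounded_integral_le PP1).
- exact/bounded_measurable_norm/(bounded_measurableB (kernel_bounded ku) bs).
- exact: bounded_measurable_cst.
- by move=> z; exact: layers_approx.
Qed.

(** By definition of the cut norm the claim holds for the indicators of
    rectangles; it extends to all measurable sets by Dynkin's lemma, and to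
    graphons by rounding down. *)
Lemma cut_continuous_kernel v : kernel v -> cut_continuous v.
Proof.
move=> kv; have [mv _ v01] := kv.
apply: cut_continuous_lim; first exact: kernel_bounded.
move=> e e0; have [N N0 Ne] := invr_nat_lt e0.
exists (fun z => N%:R^-1 * \sum_(i < N) \1_(layers v N i) z); last first.
  exact: le_lt_trans (layers_approx_L1 N0 kv) Ne.
apply: cut_continuousZ; elim: (index_enum _) => [|i s ih].
  under eq_fun do rewrite big_nil.
  have := cut_continuousZ 0 (cut_continuous_setX measurableT measurableT).
  by under eq_fun do rewrite mul0r.
under eq_fun do rewrite big_cons.
apply: cut_continuousD ih; apply: cut_continuous_indic.
exact: measurable_layers.
Qed.

End cut_continuous.

(** * Orbits are dense in weak isomorphism classes *)

Section orbit.
Context d (Omega : measurableType d) (R : realType) (P : probability Omega R).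
Local Notation PP := (P \x P)%E.
Local Notation OO := (Omega * Omega)%type.
Local Notation PP1 := (product_probability_setT P).
Implicit Types (u v : OO -> R) (w : graphon P).
Local Notation rep := graphon_rep.

Local Notation sqnorm w := (\int[PP]_z (rep w z * rep w z)).

(** If [psi] brings [w] close to [w'] in cut norm, then, since relabelling
    preserves the L2 norm,
    || w^psi - w' ||^2 = || w ||^2 - || w' ||^2 - 2 <w^psi - w', w'>,
    where the scalar product is small. *)
Lemma cut_dist0_L2 w w' e : cut_dist w w' = 0 -> 0 < e ->
  exists2 psi, invertible_mpt P psi &
    \int[PP]_z ((relabel (rep w) psi z - rep w' z) *
                (relabel (rep w) psi z - rep w' z)) <
    sqnorm w - sqnorm w' + e.
Proof.
move=> ww' e0; have kw := graphon_rep_kernel w.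
have kw' := graphon_rep_kernel w'.
have [bw' /(_ (e / 2))[|r r0 hr]] := cut_continuous_kernel P kw'.
  by rewrite divr_gt0.
have [psi ipsi hpsi] : exists2 psi, invertible_mpt P psi &
    cut_norm P (relabel (rep w) psi \- rep w') < r.
  by apply: cut_dist_ltP; rewrite ww'.
exists psi => //; set a := relabel (rep w) psi; set b := rep w'.
have ka : kernel a := relabel_kernel ipsi kw.
have ba := kernel_bounded ka; have bb := kernel_bounded kw'.
have bab := bounded_measurableB ba bb.
have ab1 z : `|(a \- b) z| <= 1.
  have [_ _ /(_ z)/andP[a0 a1]] := ka; have [_ _ /(_ z)/andP[b0 b1]] := kw'.
  by rewrite /= ler_norml; apply/andP; split; rewrite /b; lra.
have /ltr_normlP[h _] := hr _ bab.1 ab1 hpsi.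
have -> : sqnorm w = \int[PP]_z (a z * a z).
  rewrite -(relabel_integral ipsi)//.
  exact: bounded_measurableM (kernel_bounded kw) (kernel_bounded kw).
have -> : \int[PP]_z ((a z - b z) * (a z - b z)) =
    \int[PP]_z (a z * a z) - \int[PP]_z (b z * b z) -
    2 * \int[PP]_z ((a z - b z) * b z).
  rewrite -(bounded_integralZ PP1); last exact: bounded_measurableM bab bb.
  rewrite -(bounded_integralB PP1); try exact: bounded_measurableM.
  rewrite -(bounded_integralB PP1); last 2 first.
  - by apply: bounded_measurableB; exact: bounded_measurableM.
  - exact/bounded_measurableZ/(bounded_measurableM bab bb).
  by apply: eq_Rintegral => z _; ring.
move: h => /=; lra.
Qed.

Lemma cut_dist0_sqnorm_le w w' : cut_dist w w' = 0 -> sqnorm w' <= sqnorm w.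
Proof.
move=> ww'; rewrite leNgt; apply/negP => lt.
(* For this [e] the squared L2 distance would be negative. *)
have [|psi _] := cut_dist0_L2 ww' (e := sqnorm w' - sqnorm w).
  by rewrite subr_gt0.
rewrite [X in _ < X](_ : _ = 0) ?ltNge; last by lra.
by rewrite Rintegral_ge0// => z _; rewrite -expr2 sqr_ge0.
Qed.

(** The orbit of [w] is dense in its weak isomorphism class for the L1
    distance. *)
Lemma orbit_dense w w' e : cut_dist w w' = 0 -> 0 < e ->
  exists2 psi, invertible_mpt P psi &
    \int[PP]_z `|relabel (rep w) psi z - rep w' z| < e.
Proof.
move=> ww' e0; have ee0 : 0 < e * e / 2 by rewrite divr_gt0// mulr_gt0.
have [psi ipsi] := cut_dist0_L2 ww' ee0.
have -> : sqnorm w = sqnorm w'.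
  by apply/eqP; rewrite eq_le !cut_dist0_sqnorm_le// cut_dist_sym.
rewrite subrr add0r => h; exists psi => //.
have kw := graphon_rep_kernel w.
have kw' := graphon_rep_kernel w'.
have bab := bounded_measurableB (kernel_bounded (relabel_kernel ipsi kw))
  (kernel_bounded kw').
set f := fun z => relabel (rep w) psi z - rep w' z.
have bf : bounded_measurable f by [].
have bff : bounded_measurable (fun z => f z * f z).
  exact: (bounded_measurableM bf bf).
(* 2 e |x| <= e^2 + x^2 bounds the L1 norm by the L2 norm. *)
have le : \int[PP]_z `|f z| <=
    \int[PP]_z (e / 2 + (2 * e)^-1 * (f z * f z)).
  apply: (bounded_integral_le PP1).
  - exact: bounded_measurable_norm.
  - apply: bounded_measurableD; first exact: bounded_measurable_cst.
    exact: bounded_measurableZ.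
  - move=> z; rewrite -[f z * f z]expr2 -real_normK ?num_real//.
    rewrite -subr_ge0 (_ : _ - _ = (2 * e)^-1 * (e - `|f z|) ^+ 2).
      by rewrite mulr_ge0 ?sqr_ge0// invr_ge0 mulr_ge0// ltW.
    by field; rewrite lt0r_neq0.
apply: le_lt_trans le _.
rewrite (bounded_integralD PP1); last 2 first.
- exact: bounded_measurable_cst.
- exact: bounded_measurableZ.
rewrite (bounded_integral_cst PP1) (bounded_integralZ PP1)//.
have : (2 * e)^-1 * \int[PP]_z (f z * f z) < (2 * e)^-1 * (e * e / 2).
  by rewrite ltr_pM2l// invr_gt0 mulr_gt0.
rewrite (_ : _ * (e * e / 2) = e / 4); first lra.
by field; rewrite lt0r_neq0.
Qed.

End orbit.

(** * Completeness and separability of the space of graphons *)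

Section graphon_space.
Context d (Omega : measurableType d) (R : realType) (P : probability Omega R).
Local Notation PP := (P \x P)%E.
Local Notation OO := (Omega * Omega)%type.
Local Notation PP1 := (product_probability_setT P).
Implicit Types (u v : OO -> R) (w : graphon P).
Local Notation rep := graphon_rep.

Let rep_bounded w : bounded_measurable (rep w).
Proof. exact/kernel_bounded/graphon_rep_kernel. Qed.

(** The sum of the successive differences has a finite integral, hence it is
    finite almost everywhere. *)
Lemma rapidly_cauchy_ae_cvg (a : nat -> OO -> R) :
  (forall n, bounded_measurable (a n)) ->
  (forall n, \int[PP]_z `|a n z - a n.+1 z| < half n) ->
  \forall z \ae PP, cvgn (a ^~ z).
Proof.
move=> ba aS; pose g n z := `|a n z - a n.+1 z|.
have bg n : bounded_measurable (g n).
  exact: (bounded_measurable_norm (bounded_measurableB (ba n) (ba n.+1))).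
have mg n : measurable_fun setT (fun z => (g n z)%:E).
  by apply/measurable_EFinP; have [] := bg n.
have g0 n z : (0 <= (g n z)%:E)%E by rewrite lee_fin /g.
pose S z := (\sum_(0 <= n <oo) (g n z)%:E)%E.
have iS : PP.-integrable setT S.
  apply/integrableP; split.
    by apply: ge0_emeasurable_sum => // n z _ _.
  rewrite (eq_integral S) => [|z _]; last first.
    by rewrite gee0_abs// nneseries_ge0.
  rewrite integral_nneseries//.
  apply: le_lt_trans (_ : (_ <= 2%:E)%E) (ltry _).
  apply: le_trans (epsilon_trick0 xpredT (ltW _ : 0 <= 2)) => //.
  apply: lee_nneseries => [n _ _|n _]; first exact: integral_ge0.
  have -> : 2 / (2 ^ n.+1)%:R = half n :> R.
    by rewrite natrX exprVn exprS invfM mulrA divff// mul1r.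
  rewrite -[leLHS]fineK ?lee_fin; first exact: ltW (aS n).
  exact: integrable_fin_num (bounded_measurable_integrable PP1 (bg n)).
apply: filterS (integrable_ae measurableT iS) => z /(_ I) Sfin.
have : cvgn (series (fun n => a n.+1 z - a n z)).
  apply: normed_cvg; apply: nondecreasing_is_cvgn.
    by apply/nondecreasing_seqP => n; rewrite /= seriesSr lerDl.
  exists (fine (S z)) => _ [n _ <-]; rewrite -lee_fin fineK//.
  rewrite /series/= -sumEFin.
  rewrite (eq_bigr (fun k => (g k z)%:E)); last first.
    by move=> k _; rewrite /g distrC.
  exact: nneseries_lim_ge.
rewrite (_ : series _ = fun n => a n z - a 0%N z); last first.
  by apply/funext => n; rewrite /series/= telescope_sumr.
move=> h; rewrite (_ : a ^~ z = cst (a 0%N z) \+ (fun n => a n z - a 0%N z)).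
  exact: is_cvgD (is_cvg_cst _) h.
by apply/funext => n /=; rewrite addrC subrK.
Qed.

Lemma graphon_complete : rapidly_complete (graphon P).
Proof.
move=> x xS; pose a n := rep (x n).
have aS n : \int[PP]_z `|a n z - a n.+1 z| < half n.
  by rewrite -L1_distE; exact: xS.
have ka n : kernel (a n) by exact: graphon_rep_kernel.
have acvg := rapidly_cauchy_ae_cvg (fun n => kernel_bounded (ka n)) aS.
(* Truncation keeps the limit superior in [0, 1] off the convergence set. *)
pose l z := Num.min 1 (Num.max 0 (fine (limn_esup (fun n => (a n z)%:E)))).
have kl : kernel l.
  split=> [|y z|z].
  - apply: measurable_minr; first exact: measurable_cst.
    apply: measurable_maxr; first exact: measurable_cst.
    apply: (measurableT_comp (@fine_measurable _ setT measurableT)).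
    apply: measurable_fun_limn_esup => n; apply/measurable_EFinP.
    by have [] := ka n.
  - rewrite /l; do 4 congr (_ _); apply/funext => n.
    by have [_ -> _] := ka n.
  - by rewrite le_min ler01 le_max lexx/= ge_min lexx.
have [w wl] := graphon_of_kernel P kl.
exists w; apply/cvg_ballP => e e0.
have : \int[PP]_z `|a n z - l z| @[n --> \oo] --> (0 : R).
  apply: (bounded_convergence PP1 (c := 1)).
  - by move=> n; have [] := ka n.
  - by have [] := kl.
  - by move=> n z; have [_ _ /(_ z)/andP[? ?]] := ka n; rewrite ger0_norm.
  - by move=> z; have [_ _ /(_ z)/andP[? ?]] := kl; rewrite ger0_norm.
  apply: filterS acvg => z az; rewrite (_ : l z = limn (a ^~ z))//.
  have h : (fun n => (a n z)%:E) @ \oo --> (limn (a ^~ z))%:E.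
    by apply: cvg_EFin => //; apply: nearW.
  have [_ le] := cvg_limn_einf_sup h; rewrite /l le/=.
  have l0 : 0 <= limn (a ^~ z).
    apply: limr_ge => //; apply: nearW => n.
    by have [_ _ /(_ z)/andP[]] := ka n.
  have l1 : limn (a ^~ z) <= 1.
    apply: limr_le => //; apply: nearW => n.
    by have [_ _ /(_ z)/andP[]] := ka n.
  by rewrite (max_idPr l0) (min_idPr l1).
move=> /cvgrPdist_lt/(_ _ e0); apply: filterS => n.
rewrite sub0r normrN ger0_norm ?Rintegral_ge0// => h.
change (L1_dist w (x n) < e); rewrite L1_distE.
apply: le_lt_trans h; rewrite le_eqVlt; apply/orP; left; apply/eqP.
have [mw _ _] := graphon_rep_kernel w; have [man _ _] := ka n.
have [ml _ _] := kl.
apply: Rintegral_ae_eq.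
- by apply: measurableT_comp => //; exact: measurable_funB.
- by apply: measurableT_comp => //; exact: measurable_funB.
- by apply: filterS (graphon_rep_of_ae wl) => z hw hz; rewrite hw// distrC.
Qed.

(** The average of the indicators of the sets indexed by [s]; these countably
    many functions are dense among graphons when the sets [C i] are dense
    among measurable sets. *)
Definition layer_function (C : nat -> set OO) (s : seq nat) (z : OO) : R :=
  (size s)%:R^-1 * \sum_(i <- s) \1_(C i) z.

Lemma graphon_separable : countably_generated Omega ->
  exists u : nat -> graphon P,
    forall w (e : R), 0 < e -> exists i, ball (u i) e w.
Proof.
move=> gO; have [G mG Gs] := countably_generated_prod gO gO.
pose C := boolean_sets G; have mC n : measurable (C n).
  exact: measurable_boolean_sets.
pose v := layer_function C.
have bv s : bounded_measurable (v s).
  apply: bounded_measurableZ; apply: bounded_measurable_sum => i.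
  exact: bounded_measurable_indic.
have vP w e : 0 < e -> exists s, \int[PP]_z `|rep w z - v s z| < e.
  move=> e0; have e20 : 0 < e / 2 by rewrite divr_gt0.
  have [N N0 Ne] := invr_nat_lt e20.
  have [mw _ _] := graphon_rep_kernel w.
  have mL i := measurable_layers N i mw.
  have /choice[c cP] i := boolean_sets_dense PP1 mG (Gs _ (mL i)) e20.
  exists [seq c i | i <- iota 0 N].
  pose m z : R := N%:R^-1 * \sum_(i < N) \1_(layers (rep w) N i) z.
  have bm : bounded_measurable m.
    apply: bounded_measurableZ; apply: bounded_measurable_sum => i.
    exact: bounded_measurable_indic.
  apply: le_lt_trans (bounded_integral_triangle PP1 (rep_bounded w) bm
    (bv _)) _.
  rewrite (splitr e); apply: ltr_leD.
    exact: le_lt_trans (layers_approx_L1 _ N0 (graphon_rep_kernel w)) Ne.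
  pose D i z : R := `|\1_(layers (rep w) N i) z - \1_(C (c i)) z|.
  have bD i : bounded_measurable (D i).
    apply: bounded_measurable_norm; apply: bounded_measurableB;
      exact: bounded_measurable_indic.
  have sumD : \int[PP]_z \sum_(i < N) D i z = \sum_(i < N) \int[PP]_z D i z.
    elim: (index_enum _) => [|i s ih].
      rewrite big_nil; under eq_Rintegral do rewrite big_nil.
      exact: (bounded_integral_cst PP1).
    rewrite big_cons; under eq_Rintegral do rewrite big_cons.
    by rewrite (bounded_integralD PP1) ?ih//; exact: bounded_measurable_sum.
  have N0' : 0 < N%:R :> R by rewrite ltr0n.
  apply: (@le_trans _ _ (\int[PP]_z (N%:R^-1 * \sum_(i < N) D i z))).
    apply: (bounded_integral_le PP1).
    - exact/bounded_measurable_norm/bounded_measurableB.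
    - by apply: bounded_measurableZ; exact: bounded_measurable_sum.
    move=> z; rewrite /m /v /layer_function size_map size_iota big_map.
    rewrite -(subn0 N) -/(index_iota 0 N) big_mkord subn0.
    rewrite -mulrBr normrM ger0_norm ?invr_ge0 ?(ltW N0')//.
    rewrite ler_wpM2l ?invr_ge0 ?(ltW N0')// -sumrB.
    exact: ler_norm_sum.
  rewrite (bounded_integralZ PP1); last exact: bounded_measurable_sum.
  rewrite sumD ler_pdivrMl//.
  apply: (@le_trans _ _ (\sum_(i < N) (e / 2))).
    by apply: ler_sum => i _; exact/ltW/cP.
  by rewrite sumr_const card_ord mulr_natl.
(* Layer functions need not be symmetric: each of them is replaced, for every
   [n], by some graphon at distance less than [half n], if there is one. *)
pose near_graphon (sn : seq nat * nat) w :=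
  \int[PP]_z `|rep w z - v sn.1 z| < half sn.2.
pose u n := xget point (near_graphon (odflt ([::], 0%N) (unpickle n))).
exists u => w e e0; have [n ne] := half_lt 2 e0.
have [s ws] := vP w _ (half_gt0 R n).
exists (pickle (s, n)); rewrite /u pickleK/=.
case: xgetP => [w' _ w's|/(_ w)//].
change (L1_dist w' w < e); rewrite L1_distE.
apply: le_lt_trans (bounded_integral_triangle PP1 (rep_bounded w') (bv s)
  (rep_bounded w)) _.
apply: lt_trans ne; rewrite mulr_natl mulr2n; apply: ltrD => //.
by under eq_Rintegral do rewrite distrC.
Qed.

(** * The quotient by weak isomorphism *)

Local Notation p := (\pi_(unlabeled_graphon P)).

Lemma weak_piE w w' : p w = p w' <-> cut_dist w w' = 0.
Proof. by split=> [/eqmodP/asboolP//|h]; apply/eqmodP/asboolP. Qed.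

Lemma invertible_mpt_id : invertible_mpt P id.
Proof. by split=> //; exists id; split. Qed.

Lemma cut_dist_le_L1 w w' : cut_dist w w' <= L1_dist w w'.
Proof.
rewrite L1_distE; apply: le_trans (cut_dist_le w w' invertible_mpt_id) _.
by rewrite le_eqVlt; apply/orP; left; apply/eqP; apply: eq_Rintegral => -[].
Qed.

Lemma continuous_pi : continuous (p : graphon P -> unlabeled_graphon P).
Proof.
move=> w; apply/(@cvg_ballP _ _ _ _ (nbhs_filter w)) => e e0.
apply/nbhs_ballP; exists e => //= w' ww'.
change (unlabeled_cut_dist (p w) (p w') < e); rewrite unlabeled_cut_distE.
exact: le_lt_trans (cut_dist_le_L1 w w') ww'.
Qed.

(** Every relabelling of [w] represents a graphon weakly isomorphic to [w]. *)
Lemma relabelled_graphon w psi : invertible_mpt P psi ->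
  exists2 w', p w' = p w & rep w' = relabel (rep w) psi %[ae PP].
Proof.
move=> ipsi; have kw := relabel_kernel ipsi (graphon_rep_kernel w).
have [w' /graphon_rep_of_ae w'E] := graphon_of_kernel P kw; exists w' => //.
apply/esym/weak_piE/eqP; rewrite eq_le cut_dist_ge0 andbT.
apply: (le_trans (cut_dist_le _ _ ipsi)).
have [mw _ _] := kw; have [mw' _ _] := graphon_rep_kernel w'.
rewrite (Rintegral_ae_eq (g := cst 0)) ?(bounded_integral_cst PP1)//.
  by apply: measurableT_comp => //; exact: measurable_funB.
by apply: filterS w'E => z h hz; rewrite h// subrr normr0.
Qed.

Lemma open_saturation (U : set (graphon P)) : open U ->
  open [set w | exists2 w', U w' & p w' = p w].
Proof.
move=> oU; rewrite openE => w [w' Uw' w'w].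
have /nbhs_ballP[e /= e0 eU] : nbhs w' U by exact: open_nbhs_nbhs.
have e20 : 0 < e / 2 by rewrite divr_gt0.
have [psi ipsi psiw] := orbit_dense ((weak_piE _ _).1 (esym w'w)) e20.
apply/nbhs_ballP; exists (e / 2) => //= y wy.
have [y' y'y y'E] := relabelled_graphon y ipsi; exists y' => //; apply: eU.
change (L1_dist w' y' < e); rewrite L1_distE.
have ky := graphon_rep_kernel y; have kw := graphon_rep_kernel w.
have by_ := kernel_bounded (relabel_kernel ipsi ky).
have bw := kernel_bounded (relabel_kernel ipsi kw).
have -> : \int[PP]_z `|rep w' z - rep y' z| =
    \int[PP]_z `|rep w' z - relabel (rep y) psi z|.
  apply: Rintegral_ae_eq.
  - apply: measurableT_comp => //; apply: measurable_funB.
      by have [] := graphon_rep_kernel w'.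
    by have [] := graphon_rep_kernel y'.
  - apply: measurableT_comp => //; apply: measurable_funB.
      by have [] := graphon_rep_kernel w'.
    by have [] := by_.
  - by apply: filterS y'E => z h hz; rewrite h.
apply: le_lt_trans (bounded_integral_triangle PP1 (rep_bounded w') bw by_) _.
rewrite (splitr e); apply: ltrD.
  by under eq_Rintegral do rewrite distrC.
have : L1_dist w y < e / 2 by [].
rewrite L1_distE.
rewrite -(relabel_integral ipsi)//.
exact/bounded_measurable_norm/bounded_measurableB.
Qed.

End graphon_space.

Theorem theorem1 (R : realType) (d : measure_display)
    (Omega : measurableType d) (P : probability Omega R)
    (Omega_standard : standard_borel R Omega) (P_atomless : atomless P) :
  exists xi : nat -> unlabeled_graphon P -> graphon P,
    (forall n : nat,
       @measurable_fun _ _ (borel (unlabeled_graphon P)) (borel (graphon P))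
         setT (xi n)) /\
    (forall what : unlabeled_graphon P,
       range (xi ^~ what) `<=` weak_class what /\
       weak_class what `<=` closure (range (xi ^~ what))).
Proof.
have [u du] := graphon_separable P
  (standard_borel_countably_generated Omega_standard).
have sp (y : unlabeled_graphon P) : exists w : graphon P,
    \pi_(unlabeled_graphon P) w = y.
  by exists (repr y); rewrite reprK.
apply: (@castaing_representation R (graphon P) _ (borel (unlabeled_graphon P))
  u (@graphon_complete _ _ _ P) du (@weak_class _ _ _ P)) => [y|y|U oU].
- apply: (preimage_closed (D := [set y])) => [x _|]; first exact: continuous_pi.
  exact/accessible_closed_set1/hausdorff_accessible/metric_hausdorff.
- exact: sp.
- rewrite (_ : [set y | _] = \pi_(unlabeled_graphon P) @` U).
    apply: (measurable_image_open (@graphon_complete _ _ _ P) du) => //.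
    + exact: metric_hausdorff.
    + exact: continuous_pi.
    + exact: open_saturation.
  by apply/seteqP; split=> [y [w [wy Uw]]|_ [w Uw <-]]; exists w.
Qed.
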